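(* Real Value Perception Manipulation (RVPM) can be solved in polynomial time under the $l_\infty$ norm when the number of issues $d$ is a constant, for destructive control and arbitrary scoring rules.
   Context: Spatial election model: $n$ candidates $c_1,\dots,c_n$ and $m$ voters $v_1,\dots,v_m$ are points of $\mathbb R^d$. Each voter ranks candidates by increasing $l_\infty$ distance; closest ranked 1; original rankings have no ties. A scoring rule is a non-increasing $f:\{1,\dots,n\}\to\mathbb R$: a candidate ranked $t$ by a voter receives $f(t)$; totals summed; highest total wins. Given $\epsilon>0$, an adversary may replace target $c_1$ by any $\tilde c_1\in\mathbb R^d$ with $\|\tilde c_1-c_1\|_\infty\le\epsilon$; ties created by the manipulation are broken in the adversary's favor. Destructive control: decide whether some such $\tilde c_1$ makes $c_1$ lose (with $c_1$ placed behind equidistant candidates, some other candidate's total is at least $c_1$'s total). *)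

(* Defs.v *)
From Stdlib Require Import Reals Lra Lia List Bool.
Import ListNotations.
Open Scope R_scope.

Definition Rltb (a b : R) : bool := if Rlt_dec a b then true else false.
Definition Rleb (a b : R) : bool := if Rle_dec a b then true else false.

(* points of R^d are functions nat -> R; only coordinates 0..d-1 matter *)
Definition dinf (d : nat) (x y : nat -> R) : R :=
  fold_right Rmax 0 (map (fun k => Rabs (x k - y k)) (seq 0 d)).

Definition rsum (l : list R) : R := fold_right Rplus 0 l.

(* Candidates C 0, ..., C (n-1) (C 0 is the target c_1), voters V 0..V (m-1).
   x is the (possibly moved) position of the target.  Ties between the
   target and another candidate are broken against the target. *)
Definition rank_target (d n : nat) (C : nat -> nat -> R) (x v : nat -> R) : nat :=
  S (length (filter (fun i => Rleb (dinf d (C i) v) (dinf d x v)) (seq 1 (n - 1)))).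

Definition rank_other (d n : nat) (C : nat -> nat -> R) (x v : nat -> R) (j : nat) : nat :=
  S (length (filter (fun i => andb (negb (Nat.eqb i j)) (Rltb (dinf d (C i) v) (dinf d (C j) v)))
                    (seq 1 (n - 1)))
     + (if Rltb (dinf d x v) (dinf d (C j) v) then 1 else 0))%nat.

Definition score_target d n m C V (f : nat -> R) x : R :=
  rsum (map (fun v => f (rank_target d n C x (V v))) (seq 0 m)).

Definition score_other d n m C V (f : nat -> R) x j : R :=
  rsum (map (fun v => f (rank_other d n C x (V v) j)) (seq 0 m)).

Definition destructive_control (d n m : nat) (C V : nat -> nat -> R)
  (f : nat -> R) (eps : R) : Prop :=
  exists x : nat -> R,
    (forall k, (k < d)%nat -> Rabs (x k - C 0%nat k) <= eps) /\
    exists j, (1 <= j < n)%nat /\ score_other d n m C V f x j >= score_target d n m C V f x.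

Inductive instr : Type :=
| NConst (a c : nat)
| NAdd (a b c : nat)
| NSub (a b c : nat)          (* N[a] := N[b] - N[c] (truncated) *)
| RFromN (a b : nat)
| RAdd (a b c : nat)
| RSub (a b c : nat)
| RMul (a b c : nat)
| RDiv (a b c : nat)
| RLoad (a b : nat)           (* R[a] := R[N[b]] *)
| RStore (a b : nat)          (* R[N[a]] := R[b] *)
| JLtR (a b t : nat)
| JLtN (a b t : nat)
| Jmp (t : nat)
| Halt.

Record state : Type := mkState { pc : nat; Nreg : nat -> nat; Rreg : nat -> R }.

Definition updN (g : nat -> nat) (a v : nat) : nat -> nat :=
  fun i => if Nat.eqb i a then v else g i.
Definition updR (g : nat -> R) (a : nat) (v : R) : nat -> R :=
  fun i => if Nat.eqb i a then v else g i.

Definition step (P : list instr) (s : state) : option state :=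
  let N := Nreg s in let Rg := Rreg s in let p := pc s in
  match nth_error P p with
  | None => None
  | Some Halt => None
  | Some (NConst a c) => Some (mkState (S p) (updN N a c) Rg)
  | Some (NAdd a b c) => Some (mkState (S p) (updN N a (N b + N c)%nat) Rg)
  | Some (NSub a b c) => Some (mkState (S p) (updN N a (N b - N c)%nat) Rg)
  | Some (RFromN a b) => Some (mkState (S p) N (updR Rg a (INR (N b))))
  | Some (RAdd a b c) => Some (mkState (S p) N (updR Rg a (Rg b + Rg c)))
  | Some (RSub a b c) => Some (mkState (S p) N (updR Rg a (Rg b - Rg c)))
  | Some (RMul a b c) => Some (mkState (S p) N (updR Rg a (Rg b * Rg c)))
  | Some (RDiv a b c) => Some (mkState (S p) N (updR Rg a (Rg b / Rg c)))
  | Some (RLoad a b) => Some (mkState (S p) N (updR Rg a (Rg (N b))))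
  | Some (RStore a b) => Some (mkState (S p) N (updR Rg (N a) (Rg b)))
  | Some (JLtR a b t) => Some (mkState (if Rltb (Rg a) (Rg b) then t else S p) N Rg)
  | Some (JLtN a b t) => Some (mkState (if Nat.ltb (N a) (N b) then t else S p) N Rg)
  | Some (Jmp t) => Some (mkState t N Rg)
  end.

Fixpoint steps (P : list instr) (s : state) (t : nat) : option state :=
  match t with
  | O => Some s
  | S t' => match step P s with None => None | Some s' => steps P s' t' end
  end.

Definition halted (P : list instr) (s : state) : Prop := step P s = None.

(* Input encoding.  Nat registers: N[0] = n, N[1] = m, others 0.
   Real registers: R[0] = eps; R[1 + i*d + k] = C i k (i<n, k<d);
   R[1 + n*d + v*d + k] = V v k (v<m, k<d); R[1 + n*d + m*d + t] = f (t+1)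
   (t<n); all other registers 0.  Output: N[0] <> 0 means "yes". *)
Definition init_state (d n m : nat) (C V : nat -> nat -> R) (f : nat -> R) (eps : R)
  : state :=
  mkState 0
    (fun i => if Nat.eqb i 0 then n else if Nat.eqb i 1 then m else 0%nat)
    (fun r =>
       if Nat.eqb r 0 then eps
       else let q := (r - 1)%nat in
       if Nat.ltb q (n * d) then C (q / d)%nat (q mod d)%nat
       else let q2 := (q - n * d)%nat in
       if Nat.ltb q2 (m * d) then V (q2 / d)%nat (q2 mod d)%nat
       else let q3 := (q2 - m * d)%nat in
       if Nat.ltb q3 n then f (S q3) else 0).

(* Main.v *)
Require Import Defs.
From Stdlib Require Import Reals RList Lra Lia List Bool.
Import ListNotations.
(** For each coordinate [k], call breakpoints the numbers [C 0 k - eps], [C 0 k + eps] and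
    [V v k - r], [V v k + r], where [r] is the distance of some candidate to voter [v].  As
    [dinf d x v < r] says that [0 < r] and that each [x k] lies strictly between [v k - r] and
    [v k + r], the feasibility of [x] and all the ranks depend only on how each [x k] compares
    with the breakpoints of its coordinate.  Hence each [x k] may be replaced by the midpoint
    of its two neighbouring breakpoints (both equal to [x k] if it is itself a breakpoint),
    and it suffices to try the polynomially many points whose coordinates are midpoints of two
    breakpoints.

    This search is a real-valued function of the election, obtained from the input cells by
    arithmetic, comparisons and sums over candidates and voters.  The functions of the input
    and of finitely many loop indices that some code fragment evaluates in polynomial time are
    closed under these operations. *)

Local Open Scope R_scope.

(** * Sums and tests over lists *)

Lemma Rltb_spec x y : reflect (x < y) (Rltb x y).
Proof. unfold Rltb. destruct (Rlt_dec x y); now constructor. Qed.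

Lemma Rleb_spec x y : reflect (x <= y) (Rleb x y).
Proof. unfold Rleb. destruct (Rle_dec x y); now constructor. Qed.

Lemma Rleb_iff x y : Rleb x y = true <-> x <= y.
Proof. symmetry. apply reflect_iff, Rleb_spec. Qed.

Lemma Rleb_negb_Rltb x y : Rleb x y = negb (Rltb y x).
Proof. destruct (Rleb_spec x y), (Rltb_spec y x); lra || reflexivity. Qed.

Lemma rsum_app xs ys : rsum (xs ++ ys) = rsum xs + rsum ys.
Proof. induction xs as [|x xs IH]; simpl; [|rewrite IH]; lra. Qed.

Lemma rsum_map_0 {A} (g : A -> R) xs : (forall x, In x xs -> g x = 0) -> rsum (map g xs) = 0.
Proof.
  induction xs as [|x xs IH]; simpl; intros Hg; [reflexivity|].
  rewrite Hg, IH by auto. lra.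
Qed.

Lemma rsum_single (g : nat -> R) lo len t :
  (lo <= t < lo + len)%nat ->
  rsum (map (fun i => if Nat.eqb i t then g i else 0) (seq lo len)) = g t.
Proof.
  intros Ht. set (h := fun i => if Nat.eqb i t then g i else 0).
  assert (Hh : forall lo' len', ~ (lo' <= t < lo' + len')%nat ->
    rsum (map h (seq lo' len')) = 0).
  { intros lo' len' Hout. apply rsum_map_0. intros i Hi. apply in_seq in Hi. unfold h.
    destruct (Nat.eqb_spec i t); [lia|reflexivity]. }
  replace len with ((t - lo) + (1 + (lo + len - S t)))%nat by lia.
  rewrite !seq_app, !map_app, !rsum_app, (Hh lo), (Hh (_ + 1)%nat) by lia.
  replace (lo + (t - lo))%nat with t by lia. unfold h; simpl. rewrite Nat.eqb_refl. lra.
Qed.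

Definition indicator (b : bool) : R := if b then 1 else 0.

Lemma rsum_indicator {A} (p : A -> bool) xs :
  rsum (map (fun x => indicator (p x)) xs) = INR (length (filter p xs)).
Proof.
  induction xs as [|x xs IH]; simpl; [reflexivity|].
  rewrite IH. destruct (p x); cbn [indicator length]; [rewrite S_INR|]; lra.
Qed.

Lemma existsb_count {A} (p : A -> bool) xs :
  existsb p xs = Rltb 0 (INR (length (filter p xs))).
Proof.
  apply eq_true_iff_eq. rewrite <- (reflect_iff _ _ (Rltb_spec _ _)), existsb_exists.
  setoid_rewrite <- filter_In. destruct (filter p xs) as [|x ys].
  - split; [intros [y []]|simpl; lra].
  - split; [intros _; apply (lt_INR 0); simpl; lia|exists x; now left].
Qed.

Lemma existsb_flat_map {A B} (p : B -> bool) (h : A -> list B) xs :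
  existsb p (flat_map h xs) = existsb (fun x => existsb p (h x)) xs.
Proof.
  induction xs as [|x xs IH]; [reflexivity|]. cbn [flat_map existsb].
  now rewrite existsb_app, IH.
Qed.

Lemma existsb_ext {A} (p q : A -> bool) xs :
  (forall x, p x = q x) -> existsb p xs = existsb q xs.
Proof. intros Hpq. induction xs as [|x xs IH]; simpl; [|rewrite Hpq, IH]; reflexivity. Qed.

Lemma filter_length_lt {A} (p : A -> bool) x xs :
  In x xs -> p x = false -> (length (filter p xs) < length xs)%nat.
Proof.
  intros Hx Hp. pose proof (filter_length_le p xs) as Hle.
  enough (length (filter p xs) <> length xs) by lia.
  intros Heq. apply filter_length_forallb in Heq. rewrite forallb_forall in Heq.
  rewrite Heq in Hp by exact Hx. discriminate.
Qed.

(** * Real numbers up to order *)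

Lemma Rabs_le_iff x e : Rabs x <= e <-> - e <= x <= e.
Proof.
  split; [|apply Rabs_le]. intros H.
  pose proof (Rle_abs x). pose proof (Rle_abs (- x)) as H'. rewrite Rabs_Ropp in H'. lra.
Qed.

Lemma dinf_lt d x v r :
  dinf d x v < r <-> 0 < r /\ forall k, (k < d)%nat -> v k - r < x k < v k + r.
Proof.
  transitivity (0 < r /\ forall k, In k (seq 0 d) -> v k - r < x k < v k + r).
  - unfold dinf. induction (seq 0 d) as [|k ks IH]; cbn [map fold_right].
    + split; [intros Hr; split; [exact Hr|intros k []]|tauto].
    + rewrite Rmax_Rlt, IH. split.
      * intros [Hk [Hr Hks]]. split; [exact Hr|]. intros a [<-|Ha]; [|auto].
        apply Rabs_def2 in Hk. lra.
      * intros [Hr Hks]. split; [|split; [exact Hr|intros; apply Hks; now right]].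
        specialize (Hks k (or_introl eq_refl)). apply Rabs_def1; lra.
  - split; intros [Hr Hks]; (split; [exact Hr|]); intros k Hk; apply Hks.
    + apply in_seq. lia.
    + apply in_seq in Hk. lia.
Qed.

Definition midpoints (xs : list R) : list R :=
  flat_map (fun a => flat_map (fun b => [(a + b) / 2]) xs) xs.

Lemma in_midpoints xs a b : In a xs -> In b xs -> In ((a + b) / 2) (midpoints xs).
Proof.
  intros Ha Hb. apply in_flat_map. exists a. split; [exact Ha|].
  apply in_flat_map. exists b. split; [exact Hb|now left].
Qed.

Lemma existsb_midpoints p xs :
  existsb p (midpoints xs) = existsb (fun a => existsb (fun b => p ((a + b) / 2)) xs) xs.
Proof.
  unfold midpoints. rewrite existsb_flat_map. apply existsb_ext. intros a.
  rewrite existsb_flat_map. apply existsb_ext. intros b. apply orb_false_r.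
Qed.

Definition same_order (xs : list R) (x y : R) : Prop :=
  forall c, In c xs -> (x < c <-> y < c) /\ (c < x <-> c < y).

Lemma greatest_below xs (x a : R) :
  In a xs -> a <= x ->
  exists lo, In lo xs /\ lo <= x /\ forall c, In c xs -> c <= x -> c <= lo.
Proof.
  intros Ha Hax. set (below := filter (fun c => Rleb c x) xs).
  assert (Hbelow : forall c, In c below <-> In c xs /\ c <= x).
  { intros c. unfold below. rewrite filter_In. now destruct (Rleb_spec c x). }
  exists (MaxRlist below).
  destruct (proj1 (Hbelow (MaxRlist below))) as [Hin Hle].
  { apply MaxRlist_P2. exists a. now apply Hbelow. }
  split; [exact Hin|split; [exact Hle|]].
  intros c Hc Hcx. now apply MaxRlist_P1, Hbelow.
Qed.

Lemma least_above xs (x b : R) :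
  In b xs -> x <= b ->
  exists hi, In hi xs /\ x <= hi /\ forall c, In c xs -> x <= c -> hi <= c.
Proof.
  intros Hb Hxb.
  destruct (greatest_below (map Ropp xs) (- x) (- b)) as (lo & Hlo & Hlox & Hmax);
    [now apply in_map|lra|].
  apply in_map_iff in Hlo as (hi & <- & Hhi). exists hi. split; [exact Hhi|split; [lra|]].
  intros c Hc Hxc. specialize (Hmax (- c) (in_map Ropp _ _ Hc)). lra.
Qed.

(* The midpoint of the two neighbours of [x]; both are [x] itself if [x] is in the list. *)
Lemma midpoint_same_order xs x a b :
  In a xs -> a <= x -> In b xs -> x <= b ->
  exists y, In y (midpoints xs) /\ same_order xs y x.
Proof.
  intros Ha Hax Hb Hxb.
  destruct (greatest_below xs x a Ha Hax) as (lo & Hlo & Hlox & Hmax).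
  destruct (least_above xs x b Hb Hxb) as (hi & Hhi & Hxhi & Hmin).
  exists ((lo + hi) / 2). split; [now apply in_midpoints|]. intros c Hc.
  destruct (Rtotal_order c x) as [Hlt|[->|Hgt]].
  - specialize (Hmax c Hc ltac:(lra)). split; split; lra.
  - specialize (Hmax x Hc ltac:(lra)). specialize (Hmin x Hc ltac:(lra)). split; split; lra.
  - specialize (Hmin c Hc ltac:(lra)). split; split; lra.
Qed.

(** * Search in a grid *)

Fixpoint grid_search (p : (nat -> R) -> bool) (grid : nat -> list R) (k : nat)
    (x : nat -> R) : bool :=
  match k with
  | O => p x
  | S k' => existsb (fun y => grid_search p grid k' (updR x k' y)) (grid k')
  end.

Lemma grid_search_sound p grid k : forall x,
  grid_search p grid k x = true -> exists y, p y = true.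
Proof.
  induction k as [|k IH]; intros x Hx; [now exists x|].
  apply existsb_exists in Hx as (y & _ & Hy). eauto.
Qed.

Lemma grid_search_complete p grid (near : nat -> R -> Prop) k :
  (forall a, (a < k)%nat -> exists y, In y (grid a) /\ near a y) ->
  forall d x, (k <= d)%nat -> (forall a, (k <= a < d)%nat -> near a (x a)) ->
  (forall y, (forall a, (a < d)%nat -> near a (y a)) -> p y = true) ->
  grid_search p grid k x = true.
Proof.
  induction k as [|k IH]; intros Hgrid d x Hd Hx Hp; cbn [grid_search].
  - apply Hp. intros a Ha. apply Hx. lia.
  - destruct (Hgrid k) as (y & Hy & Hnear); [lia|].
    apply existsb_exists. exists y. split; [exact Hy|].
    apply (IH (fun a Ha => Hgrid a ltac:(lia)) d); [lia| |exact Hp].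
    intros a Ha. unfold updR. destruct (Nat.eqb_spec a k) as [->|]; [exact Hnear|].
    apply Hx. lia.
Qed.

(** * Execution of code fragments *)

Local Open Scope nat_scope.

Fixpoint code_at (P : list instr) (p : nat) (code : list instr) : Prop :=
  match code with
  | [] => True
  | i :: code' => nth_error P p = Some i /\ code_at P (S p) code'
  end.

Lemma code_at_app P p code1 code2 :
  code_at P p (code1 ++ code2) <->
  code_at P p code1 /\ code_at P (p + length code1) code2.
Proof.
  revert p; induction code1 as [|i code1 IH]; intros p; simpl.
  - rewrite Nat.add_0_r. tauto.
  - rewrite IH, Nat.add_succ_r. simpl. tauto.
Qed.

Lemma code_at_refl P : code_at P 0 P.
Proof.
  enough (suffix : forall code pre, P = pre ++ code -> code_at P (length pre) code)
    by now apply (suffix P []).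
  induction code as [|i code IH]; intros pre ->; simpl; [exact I|split].
  - now rewrite nth_error_app2, Nat.sub_diag.
  - specialize (IH (pre ++ [i])). rewrite length_app, Nat.add_1_r in IH.
    apply IH. now rewrite <- app_assoc.
Qed.

Definition reaches (P : list instr) (s : state) (T : nat) (s' : state) : Prop :=
  exists t, t <= T /\ steps P s t = Some s'.

Lemma reaches_refl P s : reaches P s 0 s.
Proof. now exists 0. Qed.

Lemma reaches_step P s s' T s'' :
  step P s = Some s' -> reaches P s' T s'' -> reaches P s (S T) s''.
Proof.
  intros Hstep [t [Ht Hs]]. exists (S t); split; [lia|]. simpl. now rewrite Hstep.
Qed.

Lemma reaches_trans P s1 T1 s2 T2 s3 :
  reaches P s1 T1 s2 -> reaches P s2 T2 s3 -> reaches P s1 (T1 + T2) s3.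
Proof.
  intros [t1 [Ht1 Hs1]] [t2 [Ht2 Hs2]]. exists (t1 + t2); split; [lia|].
  clear Ht1. revert s1 Hs1; induction t1 as [|t1 IH]; simpl; intros s1 Hs1.
  - congruence.
  - destruct (step P s1); [auto|discriminate].
Qed.

Lemma reaches_weaken P s T T' s' : reaches P s T s' -> T <= T' -> reaches P s T' s'.
Proof. intros [t [Ht Hs]] HT. exists t; split; [lia|exact Hs]. Qed.

Lemma reaches_iter P (inv : nat -> state -> Prop) T cnt s :
  inv 0 s ->
  (forall i s, i < cnt -> inv i s -> exists s', reaches P s T s' /\ inv (S i) s') ->
  exists s', reaches P s (cnt * T) s' /\ inv cnt s'.
Proof.
  intros Hinit Hstep. induction cnt as [|cnt IH].
  - exists s. split; [apply reaches_refl|exact Hinit].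
  - destruct IH as [s1 [Hreach Hinv]]; [auto|].
    destruct (Hstep cnt s1) as [s2 [Hreach2 Hinv2]]; [lia|exact Hinv|].
    exists s2. split; [|exact Hinv2].
    apply reaches_weaken with (cnt * T + T); [|lia]. now apply reaches_trans with s1.
Qed.

(* Runs the instruction found by [H : nth_error P p = Some i], where the program counter
   of the goal may be any term convertible to [p]. *)
Ltac run H :=
  eapply reaches_step;
  [ unfold step; cbn [pc Nreg Rreg];
    match type of H with nth_error ?P ?p = _ =>
      match goal with |- context [nth_error P ?p'] => change p' with p end
    end; rewrite H; reflexivity
  | ].

Lemma updN_eq u i v : updN u i v i = v.
Proof. unfold updN. now rewrite Nat.eqb_refl. Qed.

Lemma updN_neq u i v j : j <> i -> updN u i v j = u j.
Proof. intros H. unfold updN. now apply Nat.eqb_neq in H as ->. Qed.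

Lemma updR_eq u i v : updR u i v i = v.
Proof. unfold updR. now rewrite Nat.eqb_refl. Qed.

Lemma updR_neq u i v j : j <> i -> updR u i v j = u j.
Proof. intros H. unfold updR. now apply Nat.eqb_neq in H as ->. Qed.

Definition agree_outside {A : Type} (a b : nat) (u u' : nat -> A) : Prop :=
  forall i, i < a \/ b <= i -> u' i = u i.

Lemma agree_outside_refl {A} a b (u : nat -> A) : agree_outside a b u u.
Proof. intros i _. reflexivity. Qed.

Lemma agree_outside_trans {A} a b a' (u v w : nat -> A) :
  a <= a' -> agree_outside a b u v -> agree_outside a' b v w -> agree_outside a b u w.
Proof. intros Ha Huv Hvw i Hi. rewrite Hvw, Huv by lia. reflexivity. Qed.

Lemma agree_outside_updN a b u u' i v :
  agree_outside a b u u' -> a <= i < b -> agree_outside a b u (updN u' i v).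
Proof. intros Hu Hi j Hj. rewrite updN_neq by lia. now apply Hu. Qed.

Lemma agree_outside_updR a b u u' i v :
  agree_outside a b u u' -> a <= i < b -> agree_outside a b u (updR u' i v).
Proof. intros Hu Hi j Hj. rewrite updR_neq by lia. now apply Hu. Qed.

(** * Polynomial bounds *)

Definition poly_bounded (T : nat -> nat) : Prop :=
  exists c k, forall s, T s <= c * (s + 1) ^ k.

Lemma poly_bounded_const a : poly_bounded (fun _ => a).
Proof. exists a, 0. intros s. simpl. lia. Qed.

Lemma poly_bounded_id : poly_bounded (fun s => s).
Proof. exists 1, 1. intros s. simpl. lia. Qed.

Lemma poly_bounded_add T U :
  poly_bounded T -> poly_bounded U -> poly_bounded (fun s => T s + U s).
Proof.
  intros [c [k HT]] [c' [k' HU]]. exists (c + c'), (k + k'). intros s.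
  specialize (HT s). specialize (HU s). rewrite Nat.pow_add_r.
  assert (1 <= (s + 1) ^ k) by (apply Nat.neq_0_lt_0, Nat.pow_nonzero; lia).
  assert (1 <= (s + 1) ^ k') by (apply Nat.neq_0_lt_0, Nat.pow_nonzero; lia).
  nia.
Qed.

Lemma poly_bounded_mul T U :
  poly_bounded T -> poly_bounded U -> poly_bounded (fun s => T s * U s).
Proof.
  intros [c [k HT]] [c' [k' HU]]. exists (c * c'), (k + k'). intros s.
  rewrite Nat.pow_add_r, Nat.mul_shuffle1. now apply Nat.mul_le_mono.
Qed.

Ltac solve_poly_bounded :=
  repeat first [assumption | apply poly_bounded_const | apply poly_bounded_id
               | apply poly_bounded_add | apply poly_bounded_mul].

(** * Polynomial-time computable functions *)

(* The input of an instance occupies nat registers 0 and 1 and the first [input_length] real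
   registers; costs are polynomials in [size]. *)
Record format : Type := Format {
  instance :> Type;
  start : instance -> state;
  input_length : instance -> nat;
  size : instance -> nat }.

Arguments start {_}.
Arguments input_length {_}.
Arguments size {_}.

Definition nat_input {F : format} (e : F) (b : bool) : nat := Nreg (start e) (Nat.b2n b).
Definition real_input {F : format} (e : F) (q : nat) : R := Rreg (start e) q.

(* A point of a context consists of an instance and of the indices of the enclosing loops;
   the variables are the nat inputs and those indices. *)
Record context (F : format) : Type := Context {
  point :> Type;
  root : point -> F;
  var : Type;
  value : var -> point -> nat;
  input_var : bool -> var;
  value_input_var : forall b σ, value (input_var b) σ = nat_input (root σ) b }.

Arguments root {F Γ} : rename.
Arguments var {F} Γ : rename.
Arguments value {F Γ} : rename.
Arguments input_var {F Γ} : rename.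
Arguments value_input_var {F Γ} : rename.

Definition root_context (F : format) : context F :=
  Context F F (fun e => e) bool (fun b e => nat_input e b) (fun b => b) (fun _ _ => eq_refl).

Record loop_point {F : format} (Γ : context F) (lo : nat) (hi : Γ -> nat) : Type :=
  LoopPoint {
    outer : Γ;
    index : nat;
    index_range : lo <= index < hi outer }.

Arguments LoopPoint {F}.
Arguments outer {F Γ lo hi}.
Arguments index {F Γ lo hi}.
Arguments index_range {F Γ lo hi}.

Definition loop {F : format} (Γ : context F) (lo : nat) (hi : Γ -> nat) : context F :=
  Context F (loop_point Γ lo hi) (fun s => root (outer s)) (option (var Γ))
    (fun x s => match x with None => index s | Some y => value y (outer s) end)
    (fun b => Some (input_var b)) (fun b s => value_input_var b (outer s)).

Section Computability.
Context {F : format}.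

Definition refines {Γ Δ : context F} (π : Δ -> Γ) : Prop :=
  (forall s, root (π s) = root s) /\
  exists θ : var Γ -> var Δ, forall x s, value (θ x) s = value x (π s).

Lemma refines_id (Γ : context F) : refines (fun σ : Γ => σ).
Proof. split; [reflexivity|]. now exists (fun x => x). Qed.

Lemma refines_comp (Γ Δ Θ : context F) (π : Δ -> Γ) (ϕ : Θ -> Δ) :
  refines π -> refines ϕ -> refines (fun s => π (ϕ s)).
Proof.
  intros [Hroot [θ Hθ]] [Hroot' [θ' Hθ']]. split.
  - intros s. now rewrite Hroot.
  - exists (fun x => θ' (θ x)). intros x s. now rewrite Hθ'.
Qed.

Lemma refines_outer (Γ : context F) lo hi : refines (outer : loop Γ lo hi -> Γ).
Proof. split; [reflexivity|]. now exists Some. Qed.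

Definition stored (Γ : context F) (q : Γ -> nat) : Prop :=
  exists x : var Γ, forall σ, value x σ = q σ.

Lemma stored_input (Γ : context F) b : stored Γ (fun σ => nat_input (root σ) b).
Proof. exists (input_var b). apply value_input_var. Qed.

Lemma stored_index (Γ : context F) lo hi : stored (loop Γ lo hi) index.
Proof. now exists None. Qed.

Lemma stored_refines (Γ Δ : context F) (π : Δ -> Γ) q :
  refines π -> stored Γ q -> stored Δ (fun s => q (π s)).
Proof.
  intros [_ [θ Hθ]] [x Hx]. exists (θ x). intros s. now rewrite Hθ.
Qed.

Definition stores {Γ : context F} (ρ : var Γ -> nat) (σ : Γ) (N : nat -> nat) : Prop :=
  forall x, N (ρ x) = value x σ.

Definition nat_computable (Γ : context F) (q : Γ -> nat) : Prop :=
  exists depth T, forall K l (ρ : var Γ -> nat), (forall x, ρ x < l) -> l + depth <= K ->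
  exists code, forall P p σ N Rg, code_at P p code -> stores ρ σ N ->
  exists N', reaches P (mkState p N Rg) T (mkState (p + length code) N' Rg) /\
    agree_outside l K N N' /\ N' l = q σ.

Lemma nat_computable_ext (Γ : context F) q q' :
  (forall σ, q σ = q' σ) -> nat_computable Γ q -> nat_computable Γ q'.
Proof.
  intros Hq (depth & T & Hcode). exists depth, T. intros K l ρ Hρ Hl.
  destruct (Hcode K l ρ Hρ Hl) as [code Hcode']. exists code. intros P p σ N Rg.
  rewrite <- Hq. apply Hcode'.
Qed.

Lemma nat_computable_const (Γ : context F) c : nat_computable Γ (fun _ => c).
Proof.
  exists 1, 1. intros K l ρ Hρ Hl. exists [NConst l c]. intros P p σ N Rg [Hconst _] Hσ.
  exists (updN N l c). split; [|split].
  - run Hconst. simpl. rewrite Nat.add_1_r. apply reaches_refl.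
  - apply agree_outside_updN; [apply agree_outside_refl|lia].
  - apply updN_eq.
Qed.

Lemma nat_computable_stored (Γ : context F) q : stored Γ q -> nat_computable Γ q.
Proof.
  intros [x Hx]. exists 1, 2. intros K l ρ Hρ Hl. exists [NConst l 0; NAdd l l (ρ x)].
  intros P p σ N Rg (Hconst & Hadd & _) Hσ. specialize (Hρ x).
  exists (updN (updN N l 0) l (N (ρ x))). split; [|split].
  - run Hconst. run Hadd. rewrite updN_eq, updN_neq by lia. simpl.
    rewrite Nat.add_comm. apply reaches_refl.
  - repeat apply agree_outside_updN; try apply agree_outside_refl; lia.
  - now rewrite updN_eq, Hσ.
Qed.

Lemma nat_computable_add (Γ : context F) q q' :
  nat_computable Γ q -> nat_computable Γ q' -> nat_computable Γ (fun σ => q σ + q' σ).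
Proof.
  intros (depth & T & Hcode) (depth' & T' & Hcode').
  exists (1 + depth + depth'), (T + (T' + 1)). intros K l ρ Hρ Hl.
  destruct (Hcode K l ρ) as [code Hrun]; [exact Hρ|lia|].
  destruct (Hcode' K (S l) ρ) as [code' Hrun']; [intros x; specialize (Hρ x); lia|lia|].
  exists (code ++ code' ++ [NAdd l l (S l)]). intros P p σ N Rg Hc Hσ.
  apply code_at_app in Hc as [Hc Hc']. apply code_at_app in Hc' as [Hc' [Hadd _]].
  destruct (Hrun P p σ N Rg Hc Hσ) as (N1 & Hs1 & HN1 & Hq).
  destruct (Hrun' P _ σ N1 Rg Hc') as (N2 & Hs2 & HN2 & Hq').
  { intros x. rewrite HN1 by (left; apply Hρ). apply Hσ. }
  exists (updN N2 l (q σ + q' σ)). split; [|split].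
  - eapply reaches_trans; [exact Hs1|]. eapply reaches_trans; [exact Hs2|].
    run Hadd. rewrite HN2, Hq, Hq', !length_app, !Nat.add_assoc, Nat.add_1_r by lia.
    apply reaches_refl.
  - apply agree_outside_updN; [|lia]. now apply agree_outside_trans with (S l) N1; [lia|..].
  - apply updN_eq.
Qed.

Lemma nat_computable_mul_const (Γ : context F) q c :
  nat_computable Γ q -> nat_computable Γ (fun σ => q σ * c).
Proof.
  intros Hq. induction c as [|c IH].
  - apply nat_computable_ext with (fun _ => 0); [|apply nat_computable_const].
    intros σ. now rewrite Nat.mul_0_r.
  - apply nat_computable_ext with (fun σ => q σ + q σ * c).
    + intros σ. now rewrite Nat.mul_succ_r, Nat.add_comm.
    + now apply nat_computable_add.
Qed.

Definition holds {Γ : context F} (K : nat) (ρ : var Γ -> nat) (σ : Γ)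
    (N : nat -> nat) (Rg : nat -> R) : Prop :=
  stores ρ σ N /\ K <= N K /\
  forall q, q < input_length (root σ) -> Rg (N K + q) = real_input (root σ) q.

Lemma holds_agree_outside (Γ : context F) K l r (ρ : var Γ -> nat) σ N Rg N' Rg' :
  (forall x, ρ x < l) -> agree_outside l K N N' -> agree_outside r K Rg Rg' ->
  holds K ρ σ N Rg -> holds K ρ σ N' Rg'.
Proof.
  intros Hρ HN HR (Hσ & HK & Hin). split; [|split].
  - intros x. rewrite HN by (left; apply Hρ). apply Hσ.
  - now rewrite HN by lia.
  - intros q Hq. rewrite HN, HR by lia. now apply Hin.
Qed.

Definition achieves (P : list instr) (K l r : nat) (s : state) (T p' : nat)
    (post : (nat -> R) -> Prop) : Prop :=
  exists N' Rg', reaches P s T (mkState p' N' Rg') /\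
    agree_outside l K (Nreg s) N' /\ agree_outside r K (Rreg s) Rg' /\ post Rg'.

Lemma achieves_after P K l r s T s' T' T'' p' post :
  reaches P s T s' -> T + T' <= T'' ->
  agree_outside l K (Nreg s) (Nreg s') -> agree_outside r K (Rreg s) (Rreg s') ->
  achieves P K l r s' T' p' post -> achieves P K l r s T'' p' post.
Proof.
  intros Hs HT HN HR (N' & R' & Hs' & HN' & HR' & Hpost). exists N', R'.
  split; [|split; [|split; [|exact Hpost]]].
  - apply reaches_weaken with (T + T'); [|exact HT]. now apply reaches_trans with s'.
  - now apply agree_outside_trans with l (Nreg s').
  - now apply agree_outside_trans with r (Rreg s').
Qed.

Lemma achieves_weaken P K l r s T T' p' post :
  achieves P K l r s T p' post -> T <= T' -> achieves P K l r s T' p' post.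
Proof.
  intros (N' & R' & Hs & H) HT. exists N', R'. split; [|exact H].
  now apply reaches_weaken with T.
Qed.

Lemma achieves_jump P K l r s T p1 p2 post :
  achieves P K l r s T p1 post -> nth_error P p1 = Some (Jmp p2) ->
  achieves P K l r s (T + 1) p2 post.
Proof.
  intros (N' & R' & Hs & HN & HR & Hpost) Hjmp. exists N', R'.
  split; [|now split]. eapply reaches_trans; [exact Hs|]. run Hjmp. apply reaches_refl.
Qed.

(* Nat register [K] holds the base address of a copy of the input, so that the code may
   use nat registers from [l] on and real registers from [r] on, all below [K], as scratch;
   the variables are held in the registers given by [ρ], below [l]. *)
Definition attainable (Γ : context F) (post : Γ -> nat -> (nat -> R) -> Prop) : Prop :=
  exists depth T, poly_bounded T /\
  forall K l r p (ρ : var Γ -> nat),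
    (forall x, ρ x < l) -> l + depth <= K -> r + depth <= K ->
  exists code, forall P σ N Rg, code_at P p code -> holds K ρ σ N Rg ->
  achieves P K l r (mkState p N Rg) (T (size (root σ))) (p + length code) (post σ r).

Definition computable (Γ : context F) (g : Γ -> R) : Prop :=
  attainable Γ (fun σ r Rg => Rg r = g σ).

Lemma computable_ext (Γ : context F) g g' :
  (forall σ, g σ = g' σ) -> computable Γ g -> computable Γ g'.
Proof.
  intros Hg (depth & T & HT & Hcode). exists depth, T. split; [exact HT|].
  intros K l r p ρ Hρ Hl Hr. destruct (Hcode K l r p ρ Hρ Hl Hr) as [code Hrun].
  exists code. intros P σ N Rg. rewrite <- Hg. apply Hrun.
Qed.

Lemma computable_refines (Γ Δ : context F) (π : Δ -> Γ) g :
  refines π -> computable Γ g -> computable Δ (fun s => g (π s)).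
Proof.
  intros [Hroot [θ Hθ]] (depth & T & HT & Hcode). exists depth, T. split; [exact HT|].
  intros K l r p ρ Hρ Hl Hr.
  destruct (Hcode K l r p (fun x => ρ (θ x))) as [code Hrun]; auto.
  exists code. intros P s N Rg Hc (Hσ & HK & Hin). rewrite <- Hroot.
  apply Hrun; [exact Hc|]. split; [|split; [exact HK|]].
  - intros x. now rewrite Hσ, Hθ.
  - now rewrite Hroot.
Qed.

Lemma computable_INR (Γ : context F) q :
  nat_computable Γ q -> computable Γ (fun σ => INR (q σ)).
Proof.
  intros (depth & T & Hcode). exists (1 + depth), (fun _ => T + 1).
  split; [solve_poly_bounded|].
  intros K l r p ρ Hρ Hl Hr. destruct (Hcode K l ρ Hρ) as [code Hrun]; [lia|].
  exists (code ++ [RFromN r l]). intros P σ N Rg Hc [Hσ _].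
  apply code_at_app in Hc as [Hc [Hconvert _]].
  destruct (Hrun P p σ N Rg Hc Hσ) as (N' & Hs & HN & Hq).
  exists N', (updR Rg r (INR (q σ))). split; [|split; [exact HN|split]].
  - eapply reaches_trans; [exact Hs|]. run Hconvert.
    rewrite Hq, length_app, Nat.add_assoc, Nat.add_1_r. apply reaches_refl.
  - apply agree_outside_updR; [apply agree_outside_refl|lia].
  - apply updR_eq.
Qed.

Lemma computable_const (Γ : context F) c : computable Γ (fun _ => INR c).
Proof. apply computable_INR, nat_computable_const. Qed.

Lemma computable_input (Γ : context F) q :
  nat_computable Γ q -> (forall σ, q σ < input_length (root σ)) ->
  computable Γ (fun σ => real_input (root σ) (q σ)).
Proof.
  intros (depth & T & Hcode) Hrange. exists (1 + depth), (fun _ => T + 2).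
  split; [solve_poly_bounded|].
  intros K l r p ρ Hρ Hl Hr. destruct (Hcode K l ρ Hρ) as [code Hrun]; [lia|].
  exists (code ++ [NAdd l K l; RLoad r l]). intros P σ N Rg Hc (Hσ & HK & Hin).
  apply code_at_app in Hc as [Hc (Hadd & Hload & _)].
  destruct (Hrun P p σ N Rg Hc Hσ) as (N' & Hs & HN & Hq).
  exists (updN N' l (N K + q σ)), (updR Rg r (real_input (root σ) (q σ))).
  split; [|split; [|split]].
  - eapply reaches_trans; [exact Hs|]. run Hadd. run Hload.
    rewrite updN_eq, (HN K), Hq, Hin, length_app, Nat.add_assoc, (Nat.add_comm _ 2)
      by (lia || apply Hrange).
    apply reaches_refl.
  - apply agree_outside_updN; [exact HN|lia].
  - apply agree_outside_updR; [apply agree_outside_refl|lia].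
  - apply updR_eq.
Qed.

Lemma attainable_operands (Γ : context F) g h :
  computable Γ g -> computable Γ h ->
  attainable Γ (fun σ r Rg => Rg r = g σ /\ Rg (S r) = h σ).
Proof.
  intros (depth & T & HT & Hcode) (depth' & T' & HT' & Hcode').
  exists (1 + depth + depth'), (fun s => T s + T' s). split; [solve_poly_bounded|].
  intros K l r p ρ Hρ Hl Hr.
  destruct (Hcode K l r p ρ) as [code Hrun]; [exact Hρ|lia..|].
  destruct (Hcode' K l (S r) (p + length code) ρ) as [code' Hrun']; [exact Hρ|lia..|].
  exists (code ++ code'). intros P σ N Rg Hc Hσ. apply code_at_app in Hc as [Hc Hc'].
  destruct (Hrun P σ N Rg Hc Hσ) as (N1 & R1 & Hs1 & HN1 & HR1 & Hg).
  destruct (Hrun' P σ N1 R1 Hc') as (N2 & R2 & Hs2 & HN2 & HR2 & Hh).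
  { now apply (holds_agree_outside Γ K l r ρ σ N Rg). }
  exists N2, R2. split; [|split; [|split; [|split; [|exact Hh]]]].
  - rewrite length_app, Nat.add_assoc.
    now apply reaches_trans with (mkState (p + length code) N1 R1).
  - now apply agree_outside_trans with l N1.
  - now apply agree_outside_trans with (S r) R1; [lia|..].
  - rewrite HR2 by lia. exact Hg.
Qed.

Lemma computable_binop (Γ : context F) (mk_instr : nat -> nat -> nat -> instr)
    (op : R -> R -> R) g h :
  (forall P p N Rg a b c, nth_error P p = Some (mk_instr a b c) ->
     step P (mkState p N Rg) = Some (mkState (S p) N (updR Rg a (op (Rg b) (Rg c))))) ->
  computable Γ g -> computable Γ h -> computable Γ (fun σ => op (g σ) (h σ)).
Proof.
  intros Hop Hg Hh.
  destruct (attainable_operands Γ g h Hg Hh) as (depth & T & HT & Hcode).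
  exists (1 + depth), (fun s => T s + 1). split; [solve_poly_bounded|].
  intros K l r p ρ Hρ Hl Hr. destruct (Hcode K l r p ρ) as [code Hrun]; [exact Hρ|lia..|].
  exists (code ++ [mk_instr r r (S r)]). intros P σ N Rg Hc Hσ.
  apply code_at_app in Hc as [Hc [Hinstr _]].
  destruct (Hrun P σ N Rg Hc Hσ) as (N' & R' & Hs & HN & HR & Vg & Vh).
  exists N', (updR R' r (op (g σ) (h σ))). split; [|split; [exact HN|split]].
  - eapply reaches_trans; [exact Hs|].
    eapply reaches_step; [apply Hop, Hinstr|].
    rewrite Vg, Vh, length_app, Nat.add_assoc, Nat.add_1_r. apply reaches_refl.
  - apply agree_outside_updR; [exact HR|lia].
  - apply updR_eq.
Qed.

Lemma computable_plus (Γ : context F) g h :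
  computable Γ g -> computable Γ h -> computable Γ (fun σ => g σ + h σ)%R.
Proof.
  apply (computable_binop Γ RAdd Rplus). intros * Hinstr.
  unfold step; simpl. now rewrite Hinstr.
Qed.

Lemma computable_minus (Γ : context F) g h :
  computable Γ g -> computable Γ h -> computable Γ (fun σ => g σ - h σ)%R.
Proof.
  apply (computable_binop Γ RSub Rminus). intros * Hinstr.
  unfold step; simpl. now rewrite Hinstr.
Qed.

Lemma computable_div (Γ : context F) g h :
  computable Γ g -> computable Γ h -> computable Γ (fun σ => g σ / h σ)%R.
Proof.
  apply (computable_binop Γ RDiv Rdiv). intros * Hinstr.
  unfold step; simpl. now rewrite Hinstr.
Qed.

Lemma computable_if_lt (Γ : context F) g h g1 g2 :
  computable Γ g -> computable Γ h -> computable Γ g1 -> computable Γ g2 ->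
  computable Γ (fun σ => if Rltb (g σ) (h σ) then g1 σ else g2 σ).
Proof.
  intros Hg Hh (depth_then & T_then & HT_then & Hthen) (depth_else & T_else & HT_else & Helse).
  destruct (attainable_operands Γ g h Hg Hh) as (depth & T & HT & Hcode).
  exists (1 + depth + depth_then + depth_else), (fun s => T s + (2 + T_then s + T_else s)).
  split; [solve_poly_bounded|]. intros K l r p ρ Hρ Hl Hr.
  destruct (Hcode K l r p ρ) as [code Hrun]; [exact Hρ|lia..|].
  destruct (Helse K l r (S (p + length code)) ρ) as [code_else Hrun_else]; [exact Hρ|lia..|].
  set (p_then := S (S (p + length code) + length code_else)).
  destruct (Hthen K l r p_then ρ) as [code_then Hrun_then]; [exact Hρ|lia..|].
  exists (code ++ (JLtR r (S r) p_then :: code_else) ++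
    (Jmp (p_then + length code_then) :: code_then)).
  intros P σ N Rg Hc Hσ. apply code_at_app in Hc as [Hc Hc_else].
  apply code_at_app in Hc_else as [[Htest Hc_else] [Hjmp Hc_then]].
  cbn [length] in Hjmp, Hc_then. rewrite Nat.add_succ_r in Hjmp, Hc_then.
  fold p_then in Hc_then.
  destruct (Hrun P σ N Rg Hc Hσ) as (N' & R' & Hs & HN & HR & Vg & Vh).
  assert (Hσ' : holds K ρ σ N' R') by now apply (holds_agree_outside Γ K l r ρ σ N Rg).
  replace (p + length (_ ++ _)) with (p_then + length code_then)
    by (rewrite !length_app; simpl; unfold p_then; lia).
  assert (Hs1 : reaches P (mkState p N Rg) (T (size (root σ)) + 1)
    (mkState (if Rltb (g σ) (h σ) then p_then else S (p + length code)) N' R')).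
  { eapply reaches_trans; [exact Hs|]. run Htest. rewrite Vg, Vh. apply reaches_refl. }
  set (n := size (root σ)) in *.
  apply achieves_after with (T' := 1 + T_then n + T_else n) (1 := Hs1);
    [lia|exact HN|exact HR|].
  destruct (Rltb (g σ) (h σ)).
  - apply achieves_weaken with (T_then n); [now apply Hrun_then|lia].
  - apply achieves_weaken with (T_else n + 1); [|lia].
    eapply achieves_jump; [now apply Hrun_else|exact Hjmp].
Qed.

Definition sum_code (p l r lo a : nat) (body : list instr) : list instr :=
  [NConst l lo; RSub r r r; Jmp (6 + p + length body)] ++ body ++
  [RAdd r r (S r); NConst (S l) 1; NAdd l l (S l); JLtN l a (3 + p)].

Section SumCode.
Context (P : list instr) (K p l r lo a : nat) (body : list instr).
Context (N : nat -> nat) (Rg : nat -> R) (T : nat) (g : nat -> R).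
Hypothesis code_at_p : code_at P p (sum_code p l r lo a body).
Hypothesis bound_register : a < l.
Hypothesis nat_scratch : S l < K.
Hypothesis real_scratch : S r < K.
Hypothesis body_correct : forall i N' R',
  lo <= i < N a -> N' l = i -> agree_outside l K N N' -> agree_outside r K Rg R' ->
  achieves P K (S l) (S r) (mkState (3 + p) N' R') T (3 + p + length body)
    (fun R'' => R'' (S r) = g i).

Definition partial_sum (i : nat) (s : state) : Prop :=
  pc s = 6 + p + length body /\ Nreg s l = lo + i /\
  agree_outside l K N (Nreg s) /\ agree_outside r K Rg (Rreg s) /\
  Rreg s r = rsum (map g (seq lo i)).

Lemma sum_code_instrs :
  code_at P p [NConst l lo; RSub r r r; Jmp (6 + p + length body)] /\
  code_at P (3 + p + length body)
    [RAdd r r (S r); NConst (S l) 1; NAdd l l (S l); JLtN l a (3 + p)].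
Proof.
  apply code_at_app in code_at_p as [Hinit Hc]. apply code_at_app in Hc as [_ Hc].
  split; [exact Hinit|]. cbn [length] in Hc. now rewrite (Nat.add_comm p) in Hc.
Qed.

Lemma partial_sum_init :
  exists s, reaches P (mkState p N Rg) 3 s /\ partial_sum 0 s.
Proof.
  destruct sum_code_instrs as [(at0 & at1 & at2 & _) _].
  eexists. split; [run at0; run at1; run at2; apply reaches_refl|].
  repeat split; cbn [Nreg Rreg].
  - rewrite updN_eq. lia.
  - apply agree_outside_updN; [apply agree_outside_refl|lia].
  - apply agree_outside_updR; [apply agree_outside_refl|lia].
  - rewrite updR_eq. simpl. lra.
Qed.

Lemma partial_sum_step i s :
  i < N a - lo -> partial_sum i s ->
  exists s', reaches P s (T + 4) s' /\ partial_sum (S i) s'.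
Proof.
  destruct sum_code_instrs as [_ (at3 & at4 & at5 & at6 & _)].
  destruct s as [p1 N1 R1]. intros Hi (Hpc & Hi1 & HN1 & HR1 & Hsum).
  cbn [pc Nreg Rreg] in *. subst.
  destruct (body_correct (lo + i) N1 R1) as (N2 & R2 & Hs & HN2 & HR2 & Hg);
    [lia|assumption..|]. simpl in HN2, HR2.
  eexists. split.
  - apply reaches_weaken with (1 + (T + 3)); [|lia]. run at6.
    rewrite Hi1, (HN1 a) by lia. destruct (Nat.ltb_spec (lo + i) (N a)) as [_|]; [|lia].
    eapply reaches_trans; [exact Hs|]. run at3. run at4. run at5. apply reaches_refl.
  - repeat split; cbn [Nreg Rreg].
    + rewrite !updN_eq, updN_neq, (HN2 l), Hi1 by lia. lia.
    + repeat apply agree_outside_updN; try lia.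
      now apply agree_outside_trans with (S l) N1; [lia|..].
    + apply agree_outside_updR; [|lia]. now apply agree_outside_trans with (S r) R1; [lia|..].
    + rewrite updR_eq, (HR2 r), Hsum, Hg, seq_S, map_app, rsum_app by lia. simpl. lra.
Qed.

Lemma achieves_sum :
  achieves P K l r (mkState p N Rg) (3 + (N a - lo) * (T + 4) + 1) (7 + p + length body)
    (fun R' => R' r = rsum (map g (seq lo (N a - lo)))).
Proof.
  destruct sum_code_instrs as [_ (_ & _ & _ & at6 & _)].
  destruct partial_sum_init as (s0 & Hs0 & Hinit).
  destruct (reaches_iter P partial_sum (T + 4) (N a - lo) s0 Hinit partial_sum_step)
    as ([p' N' R'] & Hloop & Hpc & Hi & HN & HR & Hsum).
  cbn [pc Nreg Rreg] in *. subst.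
  exists N', R'. split; [|now split; [|split]].
  eapply reaches_trans; [eapply reaches_trans; [exact Hs0|exact Hloop]|].
  run at6. rewrite Hi, (HN a) by lia.
  destruct (Nat.ltb_spec (lo + (N a - lo)) (N a)); [lia|]. apply reaches_refl.
Qed.

End SumCode.

Definition loop_bound (Γ : context F) (hi : Γ -> nat) : Prop :=
  stored Γ hi /\ forall σ, hi σ <= size (root σ).

Lemma computable_sum (Γ : context F) lo hi (g : Γ -> nat -> R) :
  loop_bound Γ hi -> computable (loop Γ lo hi) (fun s => g (outer s) (index s)) ->
  computable Γ (fun σ => rsum (map (g σ) (seq lo (hi σ - lo)))).
Proof.
  intros [[x Hx] Hhi] (depth & T & HT & Hcode).
  exists (2 + depth), (fun s => 3 + s * (T s + 4) + 1). split; [solve_poly_bounded|].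
  intros K l r p ρ Hρ Hl Hr.
  destruct (Hcode K (S l) (S r) (3 + p) (fun y => match y with None => l | Some x => ρ x end))
    as [body Hbody]; [|lia..|].
  { intros [y|]; [specialize (Hρ y)|]; lia. }
  exists (sum_code p l r lo (ρ x) body). intros P σ N Rg Hc Hσ.
  assert (HNx : N (ρ x) = hi σ) by (destruct Hσ as [Hσ _]; now rewrite Hσ, Hx).
  replace (p + length _) with (7 + p + length body)
    by (unfold sum_code; rewrite !length_app; simpl; lia).
  rewrite <- HNx.
  eapply achieves_weaken; [apply achieves_sum with (T := T (size (root σ)))|];
    [exact Hc|apply Hρ|lia..| |].
  - intros i N' R' Hi HNl HN HR. rewrite HNx in Hi.
    apply code_at_app in Hc as [_ Hc]. apply code_at_app in Hc as [Hc _].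
    cbn [length] in Hc. rewrite Nat.add_comm in Hc.
    apply (Hbody P (LoopPoint Γ lo hi σ i Hi)); [exact Hc|].
    destruct (holds_agree_outside Γ K l r ρ σ N Rg N' R' Hρ HN HR Hσ) as [Hstores Hmem].
    split; [|exact Hmem]. intros [y|]; [apply Hstores|exact HNl].
  - specialize (Hhi σ). rewrite HNx. nia.
Qed.

Lemma computable_Rmax (Γ : context F) g h :
  computable Γ g -> computable Γ h -> computable Γ (fun σ => Rmax (g σ) (h σ)).
Proof.
  intros Hg Hh. eapply computable_ext; [|exact (computable_if_lt Γ g h h g Hg Hh Hh Hg)].
  intros σ. cbn. destruct (Rltb_spec (g σ) (h σ)); [now rewrite Rmax_right by lra|].
  now rewrite Rmax_left by lra.
Qed.

Lemma computable_Rabs (Γ : context F) g :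
  computable Γ g -> computable Γ (fun σ => Rabs (g σ)).
Proof.
  intros Hg. pose proof (computable_const Γ 0) as Hzero.
  eapply computable_ext; [|exact (computable_if_lt Γ g _ _ g Hg Hzero
    (computable_minus Γ _ g Hzero Hg) Hg)].
  intros σ. cbn. destruct (Rltb_spec (g σ) 0).
  - rewrite Rabs_left by assumption. lra.
  - now rewrite Rabs_right by lra.
Qed.

Definition computable_point (d : nat) (Γ : context F) (x : Γ -> nat -> R) : Prop :=
  forall k, k < d -> computable Γ (fun σ => x σ k).

Lemma computable_point_refines d (Γ Δ : context F) (π : Δ -> Γ) x :
  refines π -> computable_point d Γ x -> computable_point d Δ (fun s => x (π s)).
Proof.
  intros Hπ Hx k Hk. now apply (computable_refines Γ Δ π (fun σ => x σ k)), Hx.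
Qed.

Lemma computable_point_outer d (Γ : context F) lo hi x :
  computable_point d Γ x -> computable_point d (loop Γ lo hi) (fun s => x (outer s)).
Proof. apply (computable_point_refines d Γ (loop Γ lo hi)), refines_outer. Qed.

Lemma computable_dinf d (Γ : context F) x y :
  computable_point d Γ x -> computable_point d Γ y ->
  computable Γ (fun σ => dinf d (x σ) (y σ)).
Proof.
  intros Hx Hy. unfold dinf.
  assert (Hd : forall k, In k (seq 0 d) -> k < d) by (intros k Hk; apply in_seq in Hk; lia).
  induction (seq 0 d) as [|k ks IH]; cbn [map fold_right].
  - exact (computable_const Γ 0).
  - apply computable_Rmax; [|apply IH; intros; apply Hd; now right].
    apply computable_Rabs, computable_minus; [apply Hx|apply Hy]; apply Hd; now left.
Qed.

Definition stored_below (Γ : context F) (hi : F -> nat) (i : Γ -> nat) : Prop :=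
  stored Γ i /\ forall σ, i σ < hi (root σ).

Lemma stored_below_outer (Γ : context F) lo bound hi i :
  stored_below Γ hi i -> stored_below (loop Γ lo bound) hi (fun s => i (outer s)).
Proof.
  intros [Hi Hrange]. split; [|intros s; apply Hrange].
  apply (stored_refines Γ (loop Γ lo bound) outer); [apply refines_outer|exact Hi].
Qed.

Lemma stored_below_index (Γ : context F) lo (hi : F -> nat) :
  stored_below (loop Γ lo (fun σ => hi (root σ))) hi index.
Proof. split; [apply stored_index|]. intros s. exact (proj2 (index_range s)). Qed.

Lemma computable_sum_below (Γ : context F) hi (g : Γ -> nat -> R) :
  loop_bound Γ hi -> computable (loop Γ 0 hi) (fun s => g (outer s) (index s)) ->
  computable Γ (fun σ => rsum (map (g σ) (seq 0 (hi σ)))).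
Proof.
  intros Hhi Hg. eapply computable_ext; [|exact (computable_sum Γ 0 hi g Hhi Hg)].
  intros σ. cbn. now rewrite Nat.sub_0_r.
Qed.

(** * Polynomial-time tests *)

Definition testable (Γ : context F) (b : Γ -> bool) : Prop :=
  computable Γ (fun σ => indicator (b σ)).

Lemma testable_ext (Γ : context F) b b' :
  (forall σ, b σ = b' σ) -> testable Γ b -> testable Γ b'.
Proof. intros Hb. apply computable_ext. intros σ. now rewrite Hb. Qed.

Lemma testable_const (Γ : context F) b : testable Γ (fun _ => b).
Proof. destruct b; [exact (computable_const Γ 1)|exact (computable_const Γ 0)]. Qed.

Lemma testable_ltb (Γ : context F) g h :
  computable Γ g -> computable Γ h -> testable Γ (fun σ => Rltb (g σ) (h σ)).
Proof.
  intros Hg Hh.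
  exact (computable_if_lt Γ g h _ _ Hg Hh (testable_const Γ true) (testable_const Γ false)).
Qed.

Lemma computable_if (Γ : context F) b g h :
  testable Γ b -> computable Γ g -> computable Γ h ->
  computable Γ (fun σ => if b σ then g σ else h σ).
Proof.
  intros Hb Hg Hh. eapply computable_ext;
    [|exact (computable_if_lt Γ _ _ g h (computable_const Γ 0) Hb Hg Hh)].
  intros σ. cbn. destruct (b σ); cbn [indicator].
  - destruct (Rltb_spec 0 1); [reflexivity|lra].
  - destruct (Rltb_spec 0 0); [lra|reflexivity].
Qed.

Lemma testable_if (Γ : context F) b bt bf :
  testable Γ b -> testable Γ bt -> testable Γ bf ->
  testable Γ (fun σ => if b σ then bt σ else bf σ).
Proof.
  intros Hb Hbt Hbf. eapply computable_ext; [|exact (computable_if Γ b _ _ Hb Hbt Hbf)].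
  intros σ. cbn. now destruct (b σ).
Qed.

Lemma testable_andb (Γ : context F) b b' :
  testable Γ b -> testable Γ b' -> testable Γ (fun σ => b σ && b' σ).
Proof. intros Hb Hb'. exact (testable_if Γ b b' _ Hb Hb' (testable_const Γ false)). Qed.

Lemma testable_orb (Γ : context F) b b' :
  testable Γ b -> testable Γ b' -> testable Γ (fun σ => b σ || b' σ).
Proof. intros Hb Hb'. exact (testable_if Γ b _ b' Hb (testable_const Γ true) Hb'). Qed.

Lemma testable_leb (Γ : context F) g h :
  computable Γ g -> computable Γ h -> testable Γ (fun σ => Rleb (g σ) (h σ)).
Proof.
  intros Hg Hh. eapply testable_ext; [intros σ; symmetry; apply Rleb_negb_Rltb|].
  exact (testable_if Γ _ _ _ (testable_ltb Γ h g Hh Hg) (testable_const Γ false)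
    (testable_const Γ true)).
Qed.

Lemma testable_forallb (Γ : context F) {A} (b : Γ -> A -> bool) xs :
  (forall x, In x xs -> testable Γ (fun σ => b σ x)) ->
  testable Γ (fun σ => forallb (b σ) xs).
Proof.
  induction xs as [|x xs IH]; intros Hb; cbn [forallb].
  - apply testable_const.
  - apply testable_andb; [apply Hb; now left|]. apply IH. intros y Hy. apply Hb. now right.
Qed.

Lemma computable_count (Γ : context F) lo hi (p : Γ -> nat -> bool) :
  loop_bound Γ hi -> testable (loop Γ lo hi) (fun s => p (outer s) (index s)) ->
  computable Γ (fun σ => INR (length (filter (p σ) (seq lo (hi σ - lo))))).
Proof.
  intros Hhi Hp. eapply computable_ext; [intros σ; apply rsum_indicator|].
  now apply (computable_sum Γ lo hi (fun σ i => indicator (p σ i))).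
Qed.

Lemma testable_existsb (Γ : context F) lo hi (p : Γ -> nat -> bool) :
  loop_bound Γ hi -> testable (loop Γ lo hi) (fun s => p (outer s) (index s)) ->
  testable Γ (fun σ => existsb (p σ) (seq lo (hi σ - lo))).
Proof.
  intros Hhi Hp. eapply testable_ext; [intros σ; symmetry; apply existsb_count|].
  apply testable_ltb; [exact (computable_const Γ 0)|now apply computable_count].
Qed.

Lemma testable_existsb_below (Γ : context F) hi (p : Γ -> nat -> bool) :
  loop_bound Γ hi -> testable (loop Γ 0 hi) (fun s => p (outer s) (index s)) ->
  testable Γ (fun σ => existsb (p σ) (seq 0 (hi σ))).
Proof.
  intros Hhi Hp. eapply testable_ext; [|exact (testable_existsb Γ 0 hi p Hhi Hp)].
  intros σ. cbn. now rewrite Nat.sub_0_r.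
Qed.

Lemma testable_eqb (Γ : context F) q q' :
  computable Γ (fun σ => INR (q σ)) -> computable Γ (fun σ => INR (q' σ)) ->
  testable Γ (fun σ => q σ =? q' σ).
Proof.
  intros Hq Hq'. eapply testable_ext; [|exact (testable_andb Γ _ _
    (testable_leb Γ _ _ Hq Hq') (testable_leb Γ _ _ Hq' Hq))].
  intros σ. cbn. apply eq_true_iff_eq. rewrite andb_true_iff, Nat.eqb_eq, !Rleb_iff.
  split; [intros [Hle Hge]; apply INR_le in Hle, Hge; lia|intros ->; lra].
Qed.

(* A real cannot be used as an address, so the value at [q] is found by scanning the range. *)
Lemma computable_select (Γ : context F) lo hi (g : Γ -> nat -> R) q :
  loop_bound Γ hi -> computable (loop Γ lo hi) (fun s => g (outer s) (index s)) ->
  computable Γ (fun σ => INR (q σ)) -> (forall σ, lo <= q σ < hi σ) ->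
  computable Γ (fun σ => g σ (q σ)).
Proof.
  intros Hhi Hg Hq Hrange.
  eapply computable_ext.
  { intros σ. apply (rsum_single (g σ) lo (hi σ - lo) (q σ)). specialize (Hrange σ). lia. }
  apply (computable_sum Γ lo hi (fun σ i => if i =? q σ then g σ i else 0%R)); [exact Hhi|].
  apply computable_if; [apply testable_eqb|exact Hg|exact (computable_const _ 0)].
  - apply computable_INR, nat_computable_stored, stored_index.
  - apply (computable_refines Γ (loop Γ lo hi) outer _ (refines_outer Γ lo hi) Hq).
Qed.

(* Running through [xs] opens loops, so that the test has to be available in all contexts
   that refine [Γ]. *)
Definition enumerable (xs : F -> list R) : Prop :=
  forall (Γ : context F) (p : Γ -> R -> bool),
  (forall (Δ : context F) (π : Δ -> Γ) y, refines π -> computable Δ y ->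
     testable Δ (fun s => p (π s) (y s))) ->
  testable Γ (fun σ => existsb (p σ) (xs (root σ))).

Lemma enumerable_midpoints xs : enumerable xs -> enumerable (fun e => midpoints (xs e)).
Proof.
  intros Hxs Γ p Hp.
  eapply testable_ext; [intros σ; symmetry; apply existsb_midpoints|].
  apply (Hxs Γ (fun σ a => existsb (fun b => p σ ((a + b) / 2)%R) (xs (root σ)))).
  intros Δ π a Hπ Ha.
  apply testable_ext with (fun s =>
    existsb (fun b => p (π s) ((a s + b) / 2)%R) (xs (root s))).
  { intros s. now rewrite (proj1 Hπ). }
  apply (Hxs Δ (fun s b => p (π s) ((a s + b) / 2)%R)). intros Θ ϕ b Hϕ Hb.
  apply (Hp Θ (fun s => π (ϕ s)) (fun s => (a (ϕ s) + b s) / 2)%R).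
  - now apply refines_comp.
  - apply computable_div; [|exact (computable_const Θ 2)].
    apply computable_plus; [now apply computable_refines|exact Hb].
Qed.

Lemma testable_grid_search d (p : F -> (nat -> R) -> bool) (grid : nat -> F -> list R) :
  (forall (Γ : context F) x,
     computable_point d Γ x -> testable Γ (fun σ => p (root σ) (x σ))) ->
  (forall k, k < d -> enumerable (grid k)) ->
  forall k (Γ : context F) x, k <= d -> computable_point d Γ x ->
  testable Γ (fun σ => grid_search (p (root σ)) (fun a => grid a (root σ)) k (x σ)).
Proof.
  intros Hp Hgrid. induction k as [|k IH]; intros Γ x Hk Hx; cbn [grid_search].
  - now apply Hp.
  - apply (Hgrid k Hk Γ (fun σ y =>
      grid_search (p (root σ)) (fun a => grid a (root σ)) k (updR (x σ) k y))).
    intros Δ π y Hπ Hy.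
    apply testable_ext with (fun s => grid_search (p (root s)) (fun a => grid a (root s)) k
      (updR (x (π s)) k (y s))); [intros s; now rewrite (proj1 Hπ)|].
    apply (IH Δ (fun s => updR (x (π s)) k (y s))); [lia|]. intros a Ha. unfold updR.
    destruct (a =? k); [exact Hy|]. now apply (computable_point_refines d Γ Δ π x).
Qed.

End Computability.

(** * Decision procedures *)

(* Nat register 2 holds the length of the input.  Its cell 0 is copied first, since real
   register 0 then serves to transfer the others. *)
Definition copy_code (K p : nat) : list instr :=
  [NConst 3 K; NAdd K 2 3; RStore K 0; NConst 3 1; NConst 4 1; Jmp (10 + p);
   RLoad 0 4; NAdd 5 K 4; RStore 5 0; NAdd 4 4 3; JLtN 4 2 (6 + p)].

Section CopyCode.
Context (P : list instr) (K p : nat) (N : nat -> nat) (Rg : nat -> R).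
Hypothesis code_at_p : code_at P p (copy_code K p).
Hypothesis scratch : 6 <= K.

Definition partial_copy (i : nat) (s : state) : Prop :=
  pc s = 10 + p /\ (forall a, a < 3 -> Nreg s a = N a) /\
  Nreg s 3 = 1 /\ Nreg s 4 = 1 + i /\ Nreg s K = K + N 2 /\
  (forall q, 1 <= q < K + N 2 -> Rreg s q = Rg q) /\
  (forall q, q < 1 + i -> Rreg s (K + N 2 + q) = Rg q).

Lemma partial_copy_init :
  exists s, reaches P (mkState p N Rg) 6 s /\ partial_copy 0 s.
Proof.
  destruct code_at_p as (at0 & at1 & at2 & at3 & at4 & at5 & _).
  eexists. split; [run at0; run at1; run at2; run at3; run at4; run at5; apply reaches_refl|].
  rewrite !(updN_neq N), !updN_eq, (Nat.add_comm (N 2)) by lia.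
  repeat split; cbn [Nreg Rreg].
  - intros a Ha. now rewrite !updN_neq by lia.
  - now rewrite !updN_neq, updN_eq by lia.
  - intros q Hq. now rewrite updR_neq by lia.
  - intros q Hq. replace q with 0 by lia. now rewrite Nat.add_0_r, updR_eq.
Qed.

Lemma partial_copy_step i s :
  i < N 2 - 1 -> partial_copy i s -> exists s', reaches P s 5 s' /\ partial_copy (S i) s'.
Proof.
  destruct code_at_p as (_ & _ & _ & _ & _ & _ & at6 & at7 & at8 & at9 & at10 & _).
  destruct s as [p1 N1 R1]. intros Hi (Hpc & HN & HN3 & HN4 & HNK & HR & Hcopy).
  cbn [pc Nreg Rreg] in *. subst p1. eexists. split.
  - run at10. rewrite HN4, HN by lia.
    destruct (Nat.ltb_spec (1 + i) (N 2)) as [_|]; [|lia].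
    run at6. run at7. run at8. run at9. apply reaches_refl.
  - rewrite HN4, HNK, !updN_eq, updR_eq, HR, !updN_neq, HN3, HN4 by lia.
    repeat split; cbn [Nreg Rreg].
    + intros a Ha. rewrite !updN_neq by lia. now apply HN.
    + now rewrite !updN_neq by lia.
    + rewrite updN_eq. lia.
    + now rewrite !updN_neq by lia.
    + intros q Hq. rewrite !updR_neq by lia. now apply HR.
    + intros q Hq. destruct (Nat.eq_dec q (1 + i)) as [->|Hne].
      * now rewrite updR_eq.
      * rewrite !updR_neq by lia. apply Hcopy. lia.
Qed.

Lemma copy_code_correct :
  exists N' Rg', reaches P (mkState p N Rg) (7 + N 2 * 5) (mkState (11 + p) N' Rg') /\
    (forall a, a < 2 -> N' a = N a) /\ N' K = K + N 2 /\
    forall q, q < N 2 -> Rg' (K + N 2 + q) = Rg q.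
Proof.
  destruct partial_copy_init as (s0 & Hs0 & Hinit).
  destruct (reaches_iter P partial_copy 5 (N 2 - 1) s0 Hinit partial_copy_step)
    as ([p' N' R'] & Hloop & Hpc & HN & _ & HN4 & HNK & _ & Hcopy).
  cbn [pc Nreg Rreg] in *. subst p'. exists N', R'. split; [|split; [auto|split]].
  - apply reaches_weaken with (6 + (N 2 - 1) * 5 + 1); [|lia].
    eapply reaches_trans; [eapply reaches_trans; [exact Hs0|exact Hloop]|].
    destruct code_at_p as (_ & _ & _ & _ & _ & _ & _ & _ & _ & _ & at10 & _).
    run at10. rewrite HN4, HN by lia.
    destruct (Nat.ltb_spec (1 + (N 2 - 1)) (N 2)); [lia|]. apply reaches_refl.
  - exact HNK.
  - intros q Hq. apply Hcopy. lia.
Qed.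

End CopyCode.

Definition answer_code (p : nat) : list instr :=
  [RSub 1 1 1; NConst 0 1; JLtR 1 0 (4 + p); NConst 0 0; Halt].

Lemma answer_code_correct P p N Rg :
  code_at P p (answer_code p) ->
  exists s, reaches P (mkState p N Rg) 4 s /\ halted P s /\
    (Nreg s 0 <> 0 <-> (0 < Rg 0%nat)%R).
Proof.
  intros (at0 & at1 & at2 & at3 & at4 & _).
  assert (Hhalt : forall N' R', halted P (mkState (4 + p) N' R')).
  { intros N' R'. unfold halted, step. cbn [pc Nat.add]. now rewrite at4. }
  set (R' := updR Rg 1 (Rg 1 - Rg 1)).
  assert (Hs : reaches P (mkState p N Rg) 3
    (mkState (if Rltb 0 (Rg 0) then 4 + p else S (S (S p))) (updN N 0 1) R')).
  { run at0. run at1. run at2. unfold R'.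
    rewrite updR_eq, updR_neq, Rminus_diag by lia. apply reaches_refl. }
  destruct (Rltb_spec 0 (Rg 0)) as [Hpos|Hneg].
  - eexists. split; [apply reaches_weaken with (1 := Hs); lia|split; [apply Hhalt|]].
    now split.
  - eexists. split; [apply (reaches_trans _ _ 3 _ 1 _ Hs); run at3; apply reaches_refl|].
    split; [apply Hhalt|]. now split.
Qed.

Lemma relocate_input (F : format) :
  nat_computable (root_context F) input_length ->
  exists depth T, forall K, depth <= K ->
  exists code, forall P (e : F) N Rg, code_at P 0 code -> start e = mkState 0 N Rg ->
  exists N' Rg', reaches P (start e) (T + input_length e * 5) (mkState (length code) N' Rg') /\
    holds (Γ := root_context F) K Nat.b2n e N' Rg'.
Proof.
  intros (depth & T & Hcode). exists (6 + depth), (T + 7). intros K HK.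
  assert (Hρ : forall b, Nat.b2n b < 2) by (intros []; simpl; lia).
  destruct (Hcode K 2 Nat.b2n Hρ) as [code Hrun]; [lia|].
  exists (code ++ copy_code K (length code)). intros P e N Rg Hc Hstart.
  apply code_at_app in Hc as [Hc Hcopy].
  assert (Hinput : forall b, N (Nat.b2n b) = nat_input e b)
    by (intros b; unfold nat_input; now rewrite Hstart).
  destruct (Hrun P 0 e N Rg Hc Hinput) as (N1 & Hs1 & HN1 & Hlen).
  destruct (copy_code_correct P K (length code) N1 Rg Hcopy)
    as (N2 & R2 & Hs2 & HN2 & HK2 & HR2); [lia|].
  exists N2, R2. rewrite Hlen in Hs2, HK2, HR2. split; [|split; [|split]].
  - rewrite Hstart, length_app, (Nat.add_comm (length code)).
    apply reaches_weaken with (T + (7 + input_length e * 5)); [|lia].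
    eapply reaches_trans; [exact Hs1|exact Hs2].
  - intros b. rewrite HN2, HN1 by (try left; apply Hρ). apply Hinput.
  - lia.
  - intros q Hq. rewrite HK2, HR2 by exact Hq. change (Rg q = real_input e q).
    unfold real_input. now rewrite Hstart.
Qed.

Definition polynomial_time_decidable {F : format} (b : F -> bool) : Prop :=
  exists P c k, forall e : F, exists t s,
    t <= c * (size e + 1) ^ k /\ steps P (start e) t = Some s /\ halted P s /\
    (Nreg s 0 <> 0 <-> b e = true).

Theorem polynomial_time_decidable_of_testable {F : format} (b : F -> bool) :
  (forall e : F, pc (start e) = 0) ->
  nat_computable (root_context F) input_length ->
  (exists L, poly_bounded L /\ forall e : F, input_length e <= L (size e)) ->
  testable (root_context F) b ->
  polynomial_time_decidable b.
Proof.
  intros Hpc Hlen (L & HL & HinL) (depth' & T' & HT' & Htest).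
  destruct (relocate_input F Hlen) as (depth & T & Hrelocate).
  set (K := 2 + depth + depth').
  destruct (Hrelocate K) as [code Hcode]; [lia|].
  destruct (Htest K 2 0 (length code) Nat.b2n) as [test Hrun]; [|lia..|].
  { intros []; simpl; lia. }
  assert (Hpoly : poly_bounded (fun s => T + L s * 5 + (T' s + 4))) by solve_poly_bounded.
  destruct Hpoly as (c & k & Hck).
  set (P := code ++ test ++ answer_code (length code + length test)).
  exists P, c, k. intros e.
  pose proof (code_at_refl P) as HP. unfold P in HP at 2.
  apply code_at_app in HP as [Hc1 HP]. apply code_at_app in HP as [Hc2 Hc3].
  destruct (Hcode P e (Nreg (start e)) (Rreg (start e)) Hc1) as (N1 & R1 & Hs1 & Hholds).
  { specialize (Hpc e). destruct (start e). now cbn in *; subst. }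
  destruct (Hrun P e N1 R1 Hc2 Hholds) as (N2 & R2 & Hs2 & _ & _ & Hb).
  destruct (answer_code_correct P _ N2 R2 Hc3) as (s & Hs3 & Hhalt & Hout).
  destruct (reaches_trans P _ _ _ _ _ Hs1 (reaches_trans P _ _ _ _ _ Hs2 Hs3))
    as (t & Ht & Hs).
  exists t, s. split; [|split; [exact Hs|split; [exact Hhalt|]]].
  - specialize (Hck (size e)). specialize (HinL e). simpl root in Ht. lia.
  - rewrite Hout, Hb. destruct (b e); simpl; [|split; [lra|discriminate]].
    split; [reflexivity|lra].
Qed.

(** * Elections *)

Local Open Scope R_scope.

Record election : Type := Election {
  candidates : nat;
  voters : nat;
  candidate : nat -> nat -> R;
  voter : nat -> nat -> R;
  rule : nat -> R;
  radius : R;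
  candidates_pos : (0 < candidates)%nat }.

Section Elections.
Context (d : nat).

Definition distance (e : election) (x : nat -> R) (v : nat) : R := dinf d x (voter e v).

Definition target_rank (e : election) (x : nat -> R) (v : nat) : nat :=
  rank_target d (candidates e) (candidate e) x (voter e v).

Definition rival_rank (e : election) (x : nat -> R) (v j : nat) : nat :=
  rank_other d (candidates e) (candidate e) x (voter e v) j.

Definition target_score (e : election) (x : nat -> R) : R :=
  score_target d (candidates e) (voters e) (candidate e) (voter e) (rule e) x.

Definition rival_score (e : election) (x : nat -> R) (j : nat) : R :=
  score_other d (candidates e) (voters e) (candidate e) (voter e) (rule e) x j.

Definition loses_at (e : election) (x : nat -> R) : bool :=
  forallb (fun k => Rleb (Rabs (x k - candidate e 0%nat k)) (radius e)) (seq 0 d) &&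
  existsb (fun j => Rleb (target_score e x) (rival_score e x j)) (seq 1 (candidates e - 1)).

Lemma loses_at_iff e x :
  loses_at e x = true <->
  (forall k, (k < d)%nat -> Rabs (x k - candidate e 0%nat k) <= radius e) /\
  exists j, (1 <= j < candidates e)%nat /\ rival_score e x j >= target_score e x.
Proof.
  unfold loses_at. rewrite andb_true_iff, forallb_forall, existsb_exists.
  split; intros [Hbox [j [Hj Hscore]]]; (split; [|exists j]).
  - intros k Hk. apply Rleb_iff, Hbox, in_seq. lia.
  - apply in_seq in Hj. apply Rleb_iff in Hscore. split; [lia|lra].
  - intros k Hk. apply in_seq in Hk. apply Rleb_iff, Hbox. lia.
  - rewrite Rleb_iff, in_seq. split; [lia|lra].
Qed.

Definition breakpoints (k : nat) (e : election) : list R :=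
  [candidate e 0%nat k - radius e; candidate e 0%nat k + radius e] ++
  flat_map (fun v => flat_map (fun i =>
    [voter e v k - distance e (candidate e i) v; voter e v k + distance e (candidate e i) v])
    (seq 0 (candidates e))) (seq 0 (voters e)).

Lemma in_breakpoints_box k e y :
  y = candidate e 0%nat k - radius e \/ y = candidate e 0%nat k + radius e ->
  In y (breakpoints k e).
Proof. intros Hy. apply in_or_app. left. destruct Hy as [->| ->]; simpl; auto. Qed.

Lemma in_breakpoints_ball k e v i y :
  (v < voters e)%nat -> (i < candidates e)%nat ->
  y = voter e v k - distance e (candidate e i) v \/
  y = voter e v k + distance e (candidate e i) v ->
  In y (breakpoints k e).
Proof.
  intros Hv Hi Hy. apply in_or_app. right.
  apply in_flat_map. exists v. split; [apply in_seq; lia|].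
  apply in_flat_map. exists i. split; [apply in_seq; lia|].
  destruct Hy as [->| ->]; simpl; auto.
Qed.

Definition same_comparisons (e : election) (x y : nat -> R) : Prop :=
  forall v i, (v < voters e)%nat -> (i < candidates e)%nat ->
  Rltb (distance e x v) (distance e (candidate e i) v) =
  Rltb (distance e y v) (distance e (candidate e i) v).

Lemma target_score_same_comparisons e x y :
  same_comparisons e x y -> target_score e x = target_score e y.
Proof.
  intros Hxy. unfold target_score, score_target. f_equal. apply map_ext_in.
  intros v Hv. apply in_seq in Hv. unfold rank_target. do 3 f_equal. apply filter_ext_in.
  intros i Hi. apply in_seq in Hi. rewrite !Rleb_negb_Rltb. f_equal. apply Hxy; lia.
Qed.

Lemma rival_score_same_comparisons e x y j :
  same_comparisons e x y -> (j < candidates e)%nat -> rival_score e x j = rival_score e y j.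
Proof.
  intros Hxy Hj. unfold rival_score, score_other. f_equal. apply map_ext_in.
  intros v Hv. apply in_seq in Hv. unfold rank_other. do 3 f_equal.
  specialize (Hxy v j). unfold distance in Hxy. now rewrite Hxy by lia.
Qed.

Lemma same_comparisons_of_same_order e x y :
  (forall k, (k < d)%nat -> same_order (breakpoints k e) (x k) (y k)) ->
  same_comparisons e x y.
Proof.
  intros Hxy v i Hv Hi. set (r := distance e (candidate e i) v).
  apply eq_true_iff_eq. rewrite <- !(reflect_iff _ _ (Rltb_spec _ _)).
  unfold distance at 1 2. rewrite !dinf_lt.
  assert (Hk : forall k, (k < d)%nat ->
    voter e v k - r < x k < voter e v k + r <-> voter e v k - r < y k < voter e v k + r).
  { intros k Hk.
    destruct (Hxy k Hk (voter e v k - r)) as [_ ->];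
      [now apply in_breakpoints_ball with v i; auto|].
    destruct (Hxy k Hk (voter e v k + r)) as [-> _];
      [now apply in_breakpoints_ball with v i; auto|]. reflexivity. }
  split; intros [Hr Hball]; (split; [exact Hr|]); intros k Hkd; now apply Hk, Hball.
Qed.

Lemma loses_at_same_order e x y :
  (forall k, (k < d)%nat -> same_order (breakpoints k e) (y k) (x k)) ->
  loses_at e x = true -> loses_at e y = true.
Proof.
  intros Hxy. pose proof (same_comparisons_of_same_order e y x Hxy) as Hcmp.
  rewrite !loses_at_iff. intros [Hbox [j [Hj Hscore]]]. split.
  - intros k Hk. specialize (Hbox k Hk). rewrite Rabs_le_iff in *.
    destruct (Hxy k Hk (candidate e 0%nat k - radius e)) as [Hlo _];
      [apply in_breakpoints_box; auto|].
    destruct (Hxy k Hk (candidate e 0%nat k + radius e)) as [_ Hhi];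
      [apply in_breakpoints_box; auto|].
    destruct (Rlt_dec (y k) (candidate e 0%nat k - radius e));
      destruct (Rlt_dec (candidate e 0%nat k + radius e) (y k)); lra.
  - exists j. split; [exact Hj|].
    rewrite (rival_score_same_comparisons e y x j), (target_score_same_comparisons e y x);
      assumption || lia.
Qed.

Definition manipulable (e : election) : bool :=
  grid_search (loses_at e) (fun k => midpoints (breakpoints k e)) d (fun _ => 0).

Lemma manipulable_iff e :
  manipulable e = true <->
  destructive_control d (candidates e) (voters e) (candidate e) (voter e) (rule e) (radius e).
Proof.
  split.
  - intros He. apply grid_search_sound in He as [x Hx]. exists x. now apply loses_at_iff.
  - intros [x Hx]. apply loses_at_iff in Hx.
    apply (grid_search_complete _ _ (fun k y => same_order (breakpoints k e) y (x k))) with d;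
      [|lia|intros; lia|].
    + intros k Hk. destruct (proj1 (loses_at_iff e x) Hx) as [Hbox _].
      specialize (Hbox k Hk). rewrite Rabs_le_iff in Hbox.
      apply midpoint_same_order with (candidate e 0%nat k - radius e)
        (candidate e 0%nat k + radius e); [|lra| |lra]; apply in_breakpoints_box; auto.
    + intros y Hy. now apply loses_at_same_order with x.
Qed.

(** * The input of an election *)

Definition election_format : format := {|
  instance := election;
  start e :=
    init_state d (candidates e) (voters e) (candidate e) (voter e) (rule e) (radius e);
  input_length e := (1 + candidates e * d + voters e * d + candidates e)%nat;
  size e := (candidates e + voters e)%nat |}.

Lemma input_candidate (e : election_format) i k :
  (i < candidates e)%nat -> (k < d)%nat ->
  real_input e (1 + i * d + k) = candidate e i k.
Proof.
  intros Hi Hk. assert (i * d + k < candidates e * d)%nat by nia.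
  unfold real_input; simpl. rewrite Nat.sub_0_r.
  destruct (Nat.ltb_spec (i * d + k) (candidates e * d)); [|lia].
  rewrite Nat.add_comm, Nat.div_add, Nat.div_small, Nat.Div0.mod_add, Nat.mod_small by lia.
  reflexivity.
Qed.

Lemma input_voter (e : election_format) v k :
  (v < voters e)%nat -> (k < d)%nat ->
  real_input e (1 + candidates e * d + v * d + k) = voter e v k.
Proof.
  intros Hv Hk. assert (v * d + k < voters e * d)%nat by nia.
  unfold real_input; simpl. rewrite Nat.sub_0_r, <- Nat.add_assoc.
  destruct (Nat.ltb_spec (candidates e * d + (v * d + k)) (candidates e * d)); [lia|].
  rewrite Nat.add_comm, Nat.add_sub.
  destruct (Nat.ltb_spec (v * d + k) (voters e * d)); [|lia].
  rewrite Nat.add_comm, Nat.div_add, Nat.div_small, Nat.Div0.mod_add, Nat.mod_small by lia.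
  reflexivity.
Qed.

Lemma input_rule (e : election_format) t :
  (t < candidates e)%nat ->
  real_input e (1 + candidates e * d + voters e * d + t) = rule e (S t).
Proof.
  intros Ht. unfold real_input; simpl. rewrite Nat.sub_0_r, <- Nat.add_assoc.
  destruct (Nat.ltb_spec (candidates e * d + (voters e * d + t)) (candidates e * d)); [lia|].
  rewrite Nat.add_comm, Nat.add_sub.
  destruct (Nat.ltb_spec (voters e * d + t) (voters e * d)); [lia|].
  rewrite Nat.add_comm, Nat.add_sub.
  now destruct (Nat.ltb_spec t (candidates e)); [|lia].
Qed.

Lemma loop_bound_candidates (Γ : context election_format) :
  loop_bound Γ (fun σ => candidates (root σ)).
Proof. split; [exact (stored_input Γ false)|]. intros σ. simpl. lia. Qed.

Lemma loop_bound_voters (Γ : context election_format) :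
  loop_bound Γ (fun σ => voters (root σ)).
Proof. split; [exact (stored_input Γ true)|]. intros σ. simpl. lia. Qed.

Lemma nat_computable_candidates (Γ : context election_format) :
  nat_computable Γ (fun σ => candidates (root σ)).
Proof. apply nat_computable_stored, loop_bound_candidates. Qed.

Lemma nat_computable_voters (Γ : context election_format) :
  nat_computable Γ (fun σ => voters (root σ)).
Proof. apply nat_computable_stored, loop_bound_voters. Qed.

Ltac solve_nat_computable :=
  repeat first [assumption | apply nat_computable_const | apply nat_computable_candidates
               | apply nat_computable_voters | apply nat_computable_mul_const
               | apply nat_computable_add].

Lemma computable_radius (Γ : context election_format) :
  computable Γ (fun σ => radius (root σ)).
Proof.
  apply (computable_input Γ (fun _ => 0%nat)); [apply nat_computable_const|].
  intros σ. simpl. lia.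
Qed.

Lemma computable_candidate (Γ : context election_format) i :
  stored_below Γ candidates i -> computable_point d Γ (fun σ => candidate (root σ) (i σ)).
Proof.
  intros [Hi Hrange] k Hk. eapply computable_ext; [intros σ; now apply input_candidate|].
  apply nat_computable_stored in Hi.
  apply (computable_input Γ (fun σ => 1 + i σ * d + k)%nat); [solve_nat_computable|].
  intros σ. specialize (Hrange σ). simpl. nia.
Qed.

Lemma computable_target (Γ : context election_format) :
  computable_point d Γ (fun σ => candidate (root σ) 0%nat).
Proof.
  intros k Hk. eapply computable_ext.
  - intros σ. now apply (input_candidate (root σ) 0); [apply candidates_pos|].
  - apply (computable_input Γ (fun _ => 1 + 0 * d + k)%nat); [solve_nat_computable|].
    intros σ. pose proof (candidates_pos (root σ)). simpl. nia.
Qed.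

Lemma computable_voter (Γ : context election_format) v :
  stored_below Γ voters v -> computable_point d Γ (fun σ => voter (root σ) (v σ)).
Proof.
  intros [Hv Hrange] k Hk. eapply computable_ext; [intros σ; now apply input_voter|].
  apply nat_computable_stored in Hv.
  apply (computable_input Γ (fun σ => 1 + candidates (root σ) * d + v σ * d + k)%nat);
    [solve_nat_computable|].
  intros σ. specialize (Hrange σ). simpl. nia.
Qed.

Lemma computable_rule (Γ : context election_format) t :
  computable Γ (fun σ => INR (t σ)) ->
  (forall σ, (1 <= t σ <= candidates (root σ))%nat) ->
  computable Γ (fun σ => rule (root σ) (t σ)).
Proof.
  intros Ht Hrange.
  apply computable_ext with (fun σ : Γ => rule (root σ) (S (t σ - 1))).
  { intros σ. f_equal. specialize (Hrange σ). lia. }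
  apply (computable_select Γ 0 (fun σ => candidates (root σ))
      (fun σ i => rule (root σ) (S i)));
    [apply loop_bound_candidates| | |].
  - eapply computable_ext; [intros s; exact (input_rule _ _ (proj2 (index_range s)))|].
    apply (computable_input (loop Γ 0 _) (fun s =>
      1 + candidates (root s) * d + voters (root s) * d + index s)%nat).
    + solve_nat_computable. apply nat_computable_stored, stored_index.
    + intros s. pose proof (index_range s). simpl in *. lia.
  - apply computable_ext with (fun σ : Γ => INR (t σ) - INR 1).
    + intros σ. rewrite minus_INR; [reflexivity|apply Hrange].
    + apply computable_minus; [exact Ht|apply computable_const].
  - intros σ. specialize (Hrange σ). lia.
Qed.

(** * Testing for manipulability *)

Lemma computable_distance (Γ : context election_format) x v :
  computable_point d Γ x -> stored_below Γ voters v ->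
  computable Γ (fun σ => distance (root σ) (x σ) (v σ)).
Proof. intros Hx Hv. now apply computable_dinf, computable_voter. Qed.

Lemma computable_target_rank (Γ : context election_format) x v :
  computable_point d Γ x -> stored_below Γ voters v ->
  computable Γ (fun σ => INR (target_rank (root σ) (x σ) (v σ))).
Proof.
  intros Hx Hv. eapply computable_ext; [intros σ; symmetry; apply S_INR|].
  apply computable_plus; [|exact (computable_const Γ 1)].
  apply (computable_count Γ 1 (fun σ => candidates (root σ)) (fun σ i =>
    Rleb (distance (root σ) (candidate (root σ) i) (v σ))
         (distance (root σ) (x σ) (v σ)))); [apply loop_bound_candidates|].
  apply testable_leb; apply (computable_distance (loop Γ 1 _) _ (fun s => v (outer s)));
    try exact (stored_below_outer Γ _ _ _ v Hv).
  - apply computable_candidate, stored_below_index.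
  - now apply computable_point_outer.
Qed.

Lemma rival_rank_eq e x v j :
  rival_rank e x v j =
  S (length (filter (fun i =>
       Rltb (distance e (candidate e i) v) (distance e (candidate e j) v))
       (seq 1 (candidates e - 1)))
     + Nat.b2n (Rltb (distance e x v) (distance e (candidate e j) v))).
Proof.
  unfold rival_rank, rank_other. do 3 f_equal. apply filter_ext. intros i.
  destruct (Nat.eqb_spec i j) as [->|]; [|reflexivity].
  now destruct (Rltb_spec (distance e (candidate e j) v) (distance e (candidate e j) v)); [lra|].
Qed.

Lemma computable_rival_rank (Γ : context election_format) x v j :
  computable_point d Γ x -> stored_below Γ voters v -> stored_below Γ candidates j ->
  computable Γ (fun σ => INR (rival_rank (root σ) (x σ) (v σ) (j σ))).
Proof.
  intros Hx Hv Hj.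
  eapply computable_ext;
    [intros σ; symmetry; rewrite rival_rank_eq, S_INR, plus_INR; reflexivity|].
  apply computable_plus; [apply computable_plus|exact (computable_const Γ 1)].
  - apply (computable_count Γ 1 (fun σ => candidates (root σ)) (fun σ i =>
      Rltb (distance (root σ) (candidate (root σ) i) (v σ))
           (distance (root σ) (candidate (root σ) (j σ)) (v σ))));
      [apply loop_bound_candidates|].
    apply testable_ltb; apply (computable_distance (loop Γ 1 _) _ (fun s => v (outer s)));
      try exact (stored_below_outer Γ _ _ _ v Hv).
    + apply computable_candidate, stored_below_index.
    + exact (computable_candidate _ _ (stored_below_outer Γ _ _ _ j Hj)).
  - apply computable_ext with (fun σ : Γ => indicator (Rltb (distance (root σ) (x σ) (v σ))
      (distance (root σ) (candidate (root σ) (j σ)) (v σ)))).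
    { intros σ. now destruct (Rltb _ _). }
    apply testable_ltb; apply computable_distance; auto using computable_candidate.
Qed.

Lemma target_rank_bounds e x v : (1 <= target_rank e x v <= candidates e)%nat.
Proof.
  pose proof (candidates_pos e). unfold target_rank, rank_target. split; [lia|].
  eapply Nat.le_trans; [apply le_n_S, filter_length_le|]. rewrite length_seq. lia.
Qed.

Lemma rival_rank_bounds e x v j :
  (1 <= j < candidates e)%nat -> (1 <= rival_rank e x v j <= candidates e)%nat.
Proof.
  intros Hj. rewrite rival_rank_eq. split; [lia|].
  assert (Hlt : (length (filter (fun i =>
    Rltb (distance e (candidate e i) v) (distance e (candidate e j) v))
    (seq 1 (candidates e - 1))) < candidates e - 1)%nat).
  { rewrite <- (length_seq (candidates e - 1) 1) at 2. apply filter_length_lt with j.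
    - apply in_seq. lia.
    - now destruct (Rltb_spec (distance e (candidate e j) v) (distance e (candidate e j) v));
        [lra|]. }
  destruct (Rltb _ _); simpl; lia.
Qed.

Lemma computable_target_score (Γ : context election_format) x :
  computable_point d Γ x -> computable Γ (fun σ => target_score (root σ) (x σ)).
Proof.
  intros Hx. apply (computable_sum_below Γ (fun σ => voters (root σ)));
    [apply loop_bound_voters|].
  apply computable_rule; [|intros s; apply target_rank_bounds].
  apply computable_target_rank; [|apply stored_below_index].
  now apply computable_point_outer.
Qed.

Lemma computable_rival_score (Γ : context election_format) x j :
  computable_point d Γ x -> stored_below Γ candidates j -> (forall σ, (1 <= j σ)%nat) ->
  computable Γ (fun σ => rival_score (root σ) (x σ) (j σ)).
Proof.
  intros Hx Hj Hpos. apply (computable_sum_below Γ (fun σ => voters (root σ)));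
    [apply loop_bound_voters|].
  apply computable_rule.
  - apply computable_rival_rank; [|apply stored_below_index|now apply stored_below_outer].
    now apply computable_point_outer.
  - intros s. apply rival_rank_bounds. split; [apply Hpos|apply Hj].
Qed.

Lemma testable_loses_at (Γ : context election_format) x :
  computable_point d Γ x -> testable Γ (fun σ => loses_at (root σ) (x σ)).
Proof.
  intros Hx. apply testable_andb.
  - apply testable_forallb. intros k Hk. apply in_seq in Hk.
    apply testable_leb; [|apply computable_radius].
    apply computable_Rabs, computable_minus; [apply Hx|apply computable_target]; lia.
  - apply (testable_existsb Γ 1 (fun σ => candidates (root σ)) (fun σ j =>
      Rleb (target_score (root σ) (x σ)) (rival_score (root σ) (x σ) j)));
      [apply loop_bound_candidates|].
    apply (computable_point_outer d Γ 1 (fun σ => candidates (root σ))) in Hx.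
    apply testable_leb; [now apply computable_target_score|].
    apply computable_rival_score; [exact Hx|apply stored_below_index|].
    intros s. exact (proj1 (index_range s)).
Qed.

Lemma existsb_breakpoints p k e :
  existsb p (breakpoints k e) =
  (p (candidate e 0%nat k - radius e) || p (candidate e 0%nat k + radius e)) ||
  existsb (fun v => existsb (fun i =>
    p (voter e v k - distance e (candidate e i) v) ||
    p (voter e v k + distance e (candidate e i) v))
    (seq 0 (candidates e))) (seq 0 (voters e)).
Proof.
  unfold breakpoints. rewrite existsb_app, existsb_flat_map. cbn [existsb].
  rewrite orb_false_r. f_equal. apply existsb_ext. intros v.
  rewrite existsb_flat_map. apply existsb_ext. intros i. cbn [existsb].
  now rewrite orb_false_r.
Qed.

Lemma enumerable_breakpoints k :
  (k < d)%nat -> enumerable (F := election_format) (breakpoints k).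
Proof.
  intros Hk Γ p Hp. eapply testable_ext; [intros σ; symmetry; apply existsb_breakpoints|].
  apply testable_orb; [apply testable_orb; apply (Hp Γ (fun σ => σ) _ (refines_id Γ))|].
  - apply computable_minus; [now apply computable_target|apply computable_radius].
  - apply computable_plus; [now apply computable_target|apply computable_radius].
  - apply (testable_existsb_below Γ (fun σ => voters (root σ))); [apply loop_bound_voters|].
    set (Δ := loop Γ 0 _).
    apply (testable_existsb_below Δ (fun s => candidates (root s)));
      [apply loop_bound_candidates|].
    set (Θ := loop Δ 0 _).
    assert (Hπ : refines (fun s : Θ => outer (outer s)))
      by exact (refines_comp Γ Δ Θ _ _ (refines_outer Γ _ _) (refines_outer Δ _ _)).
    assert (Hv : stored_below Θ voters (fun s => index (outer s)))
      by apply stored_below_outer, stored_below_index.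
    assert (Hr : computable Θ (fun s =>
      distance (root s) (candidate (root s) (index s)) (index (outer s))))
      by (apply computable_distance; [apply computable_candidate, stored_below_index|exact Hv]).
    apply testable_orb; apply (Hp Θ _ _ Hπ).
    + apply computable_minus; [now apply (computable_voter Θ _ Hv)|exact Hr].
    + apply computable_plus; [now apply (computable_voter Θ _ Hv)|exact Hr].
Qed.

Lemma testable_manipulable : testable (root_context election_format) manipulable.
Proof.
  apply (testable_grid_search (F := election_format) d loses_at
    (fun k e => midpoints (breakpoints k e)) testable_loses_at)
    with (k := d) (Γ := root_context election_format) (x := fun _ _ => 0).
  - intros k Hk. now apply enumerable_midpoints, enumerable_breakpoints.
  - lia.
  - intros k _. exact (computable_const _ 0).
Qed.

Theorem manipulable_polynomial_time_decidable :
  polynomial_time_decidable (F := election_format) manipulable.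
Proof.
  apply polynomial_time_decidable_of_testable; [reflexivity| | |apply testable_manipulable].
  - solve_nat_computable.
  - exists (fun s => 1 + s * d + s * d + s)%nat. split; [solve_poly_bounded|].
    intros e. simpl. nia.
Qed.

End Elections.

Theorem theorem9 :
  forall d : nat,
  exists (P : list instr) (c k : nat),
  forall (n m : nat) (C V : nat -> nat -> R) (f : nat -> R) (eps : R),
    (0 < n)%nat ->
    0 < eps ->
    (forall t, (1 <= t)%nat -> (t < n)%nat -> f (S t) <= f t) ->
    (forall v i j, (v < m)%nat -> (i < n)%nat -> (j < n)%nat -> i <> j ->
        dinf d (C i) (V v) <> dinf d (C j) (V v)) ->
    exists (t : nat) (s : state),
      (t <= c * (n + m + 1) ^ k)%nat /\
      steps P (init_state d n m C V f eps) t = Some s /\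
      halted P s /\
      (Nreg s 0 <> 0%nat <-> destructive_control d n m C V f eps).
Proof.
  intros d.
  destruct (manipulable_polynomial_time_decidable d) as (P & c & k & Hdecides).
  exists P, c, k. intros n m C V f eps Hn _ _ _. set (e := Election n m C V f eps Hn).
  destruct (Hdecides e) as (t & s & Ht & Hs & Hhalt & Hanswer).
  exists t, s. split; [exact Ht|split; [exact Hs|split; [exact Hhalt|]]].
  now rewrite Hanswer, (manipulable_iff d e).
Qed.
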